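(* Let $n$ be a positive integer and let $\kappa_{D_n}(q)$ denote the unicellular LLT cumulant of the sequence of $n$ single cells, as defined in the context. Then \[ \kappa_{D_n}(q)\;=\;\sum_{T}\mathrm{LLT}(\nu(T))\;=\;\sum_{f\in PF_{n-1}}\mathrm{LLT}(\mu(f)), \] where the first sum runs over all labeled trees $T$ on the vertex set $[n]=\{1,\dots,n\}$ (Cayley trees), and the second sum runs over all parking functions $f$ on $n-1$ cars.
   Context: Throughout, $q$ is a formal parameter and $x_1,x_2,\dots$ are commuting variables; all functions below take values in $\mathbb{N}_+=\{1,2,\dots\}$. LLT polynomials of vertical strips. A vertical strip is a single column of $\ell\ge1$ cells whose contents are consecutive integers $c,c+1,\dots,c+\ell-1$ read from top to bottom. For a sequence $\nu=(\nu_1,\dots,\nu_k)$ of vertical strips, a cell $\alpha$ of $\nu_m$ with content $c(\alpha)$ has shifted content $\tilde c(\alpha)=k\,c(\alpha)+m$. A filling $\mathcal T$ of the cells of $\nu$ by positive integers is admissible if within each strip the entries strictly decrease from top to bottom (the cell of content $c$ has a larger entry than the cell of content $c+1$ in the same strip). Set $\mathrm{inv}(\mathcal T)=\#\{(\alpha,\beta): 0<\tilde c(\beta)-\tilde c(\alpha)<k,\ \mathcal T(\alpha)>\mathcal T(\beta)\}$ and $\mathrm{LLT}(\nu)=\sum_{\mathcal T} q^{\mathrm{inv}(\mathcal T)}\prod_{\alpha}x_{\mathcal T(\alpha)}$, the sum over admissible fillings. The cumulant. For a nonempty $B\subseteq[n]$ put $\mathrm{LLT}(B)=\sum_{g:B\to\mathbb{N}_+}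 q^{\#\{(a,b)\in B^2:\,a<b,\ g(a)>g(b)\}}\prod_{a\in B}x_{g(a)}$ (the LLT polynomial of $|B|$ single cells all of content $0$, ordered as in $B$). Define $\kappa(B)$ for all nonempty $B\subseteq[n]$ recursively by $\mathrm{LLT}(B)=\sum_{\pi}(q-1)^{|B|-|\pi|}\prod_{C\in\pi}\kappa(C)$, the sum over all set partitions $\pi$ of $B$ ($|\pi|$ = number of blocks); this determines each $\kappa(B)$ uniquely. Then $\kappa_{D_n}(q):=\kappa([n])$. Shapes of trees. For a tree $T$ on $[n]$, root it at $1$. Form the first strip by starting at $1$ and repeatedly moving to the child with the smallest label until reaching a leaf; the visited vertices, in order, are the cells of $\nu_1$ from top to bottom. Then backtrack along previously visited vertices to the most recently visited vertex that still has unvisited children, take its unvisited child with the smallest label, and form the next strip starting at that child by the same rule. Repeat until all vertices are visited, obtaining strips $\nu_1,\dots,\nu_k$ in this order. The cell of vertex $v$ is given content equal to the distance from $v$ to $1$ in $T$. This sequence of vertical strips is $\nu(T)$. Schröder paths. A Schröder path of length $n$ is a lattice path from $(0,0)$ to $(n,n)$ with steps $n=(0,1)$, $e=(1,0)$, $d=(1,1)$, never going below the line $y=x$ and with no $d$ step on that line. The box $(i,j)$ is the unit square with lower-left corner $(i-1,j-1)$; a $d$ step from $(i-1,j-1)$ to $(i,j)$ is said to lie in box $(i,j)$. For such a path $P$ (with box $(i,i)$ labeled $i$), $\mu(P)$ is the associated sequence of vertical strips, whose LLT polynomial is \[\mathrm{LLT}(\mu(P))=\sum_{g:[n]\to\mathbb{N}_+}\Big[\,g(i)>g(j)\text{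 for every box }(i,j)\text{ containing a }d\text{ step of }P\Big]\; q^{\#\{(i,j):\,i<j,\ \text{box }(i,j)\text{ lies weakly below }P,\ g(i)>g(j)\}}\prod_{i=1}^n x_{g(i)}.\] Parking functions. A parking function on $n-1$ cars is a map $f:[n-1]\to[n-1]$ with $|f^{-1}([i])|\ge i$ for $1\le i\le n-1$; $PF_{n-1}$ is the set of them. Let $D_f$ be the path from $(1,1)$ to $(n,n)$ which, for $i=1,\dots,n-1$, takes $|f^{-1}(i)|$ north steps followed by one east step. Let $P_f$ be the Schröder path of length $n$ obtained from the path $n\,e\,D_f$ (from $(0,0)$ to $(n,n)$) by replacing every consecutive pair of steps $e\,n$ by a single step $d$. Set $\mu(f):=\mu(P_f)$. *)

(* Defs.v *)
From HB Require Import structures.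
From mathcomp Require Import all_boot all_order all_algebra.
From mathcomp Require Import finmap multiset.
From mathcomp Require Import boolp functions.

Set Implicit Arguments.
Unset Strict Implicit.
Unset Printing Implicit Defensive.

Import Order.TTheory GRing.Theory Num.Theory.

Local Open Scope ring_scope.

(* Formal power series in countably many commuting variables. The variables  *)
(* are indexed by nat, so that i : nat stands for x_{i+1}: only the order of *)
(* the indices matters. A monomial is the multiset of the indices of its     *)
(* variables, and a series maps every monomial to its coefficient.           *)

Notation monomial := {mset nat}%mset.

Definition fps (R : Type) := monomial -> R.

Definition submsets (m : monomial) : seq monomial :=
  undup [seq seq_mset (mask (tval b) m) | b <- enum {: (size m).-tuple bool}].

Definition msplits (m : monomial) : seq (monomial * monomial) :=
  [seq (a, (m `\` a)%mset) | a <- submsets m].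

Lemma mem_submsets (m a : monomial) : (a \in submsets m) = (a `<=` m)%mset.
Proof.
rewrite mem_undup; apply/mapP/msubsetP => [[b _ ->] x | le_am].
  rewrite mset_seqE -(count_mem_mset x m).
  exact/leq_count_subseq/mask_subseq.
have /count_subseqP [s /subseqP [b sb ->] ps] :
    forall x, (count_mem x a <= count_mem x m)%N.
  by move=> x; rewrite !count_mem_mset.
exists (tcast sb (in_tuple b)); first by rewrite mem_enum.
by rewrite val_tcast /= -[LHS]seq_mset_id; apply/eq_seq_msetP.
Qed.

Lemma mem_msplits (m : monomial) p : (p \in msplits m) = ((p.1 `+` p.2)%mset == m).
Proof.
apply/mapP/eqP => [[a] | <-].
  by rewrite mem_submsets => le_am -> /=; rewrite msetBDKC.
exists p.1; last by rewrite msetDKB; case: p.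
by rewrite mem_submsets; apply/msubsetP => x; rewrite msetE2 leq_addr.
Qed.

Lemma msplits_uniq (m : monomial) : uniq (msplits m).
Proof. by rewrite map_inj_uniq ?undup_uniq // => a b []. Qed.

Section PowerSeriesRing.

Variable R : comNzRingType.

HB.instance Definition _ := GRing.Lmodule.copy (fps R) (monomial -> R^o).

Implicit Types f g h : fps R.

Definition fps_one : fps R := fun m => (m == mset0)%:R.

Definition fps_mul f g : fps R :=
  fun m => \sum_(p <- msplits m) f p.1 * g p.2.

Fact fps_mulC : commutative fps_mul.
Proof.
move=> f g; apply/funext => m; rewrite /fps_mul.
transitivity (\sum_(p <- [seq (p.2, p.1) | p <- msplits m]) f p.1 * g p.2).
  apply: perm_big; apply: uniq_perm; first exact: msplits_uniq.
    by rewrite map_inj_uniq ?msplits_uniq // => -[a b] [c d] [-> ->].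
  move=> [a b]; rewrite mem_msplits /=; apply/idP/mapP => [ab | [[c d]]].
    by exists (b, a); rewrite // mem_msplits /= msetDC.
  by rewrite mem_msplits /= => cd [-> ->]; rewrite msetDC.
by rewrite big_map; apply: eq_bigr => p _; rewrite mulrC.
Qed.

Fact fps_mulA : associative fps_mul.
Proof.
move=> f g h; apply/funext => m; rewrite /fps_mul.
pose F (t : monomial * (monomial * monomial)) := f t.1 * (g t.2.1 * h t.2.2).
transitivity (\sum_(t <- [seq (p.1, p') | p <- msplits m, p' <- msplits p.2]) F t).
  rewrite big_allpairs_dep; apply: eq_bigr => p _.
  by rewrite mulr_sumr.
transitivity (\sum_(t <- [seq (p'.1, (p'.2, p.2)) |
                           p <- msplits m, p' <- msplits p.1]) F t); last first.
  rewrite big_allpairs_dep; apply: eq_bigr => p _.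
  by rewrite mulr_suml; apply: eq_bigr => p' _; rewrite /F /= mulrA.
apply: perm_big; apply: uniq_perm.
- apply: allpairs_uniq_dep; [exact: msplits_uniq | by move=> *; apply: msplits_uniq |].
  move=> [[a b] [c d]] [[a' b'] [c' d']].
  move=> /allpairsPdep [x [y [hx hy [? ?]]]] /allpairsPdep [x' [y' [hx' hy' [? ?]]]].
  subst x y x' y'; rewrite !mem_msplits /= in hx hy hx' hy'.
  move=> /= [? ? ?]; subst a' c' d'.
  by move: hy hy' => /eqP <- /eqP <-.
- apply: allpairs_uniq_dep; [exact: msplits_uniq | by move=> *; apply: msplits_uniq |].
  move=> [[a b] [c d]] [[a' b'] [c' d']].
  move=> /allpairsPdep [x [y [hx hy [? ?]]]] /allpairsPdep [x' [y' [hx' hy' [? ?]]]].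
  subst x y x' y'; rewrite !mem_msplits /= in hx hy hx' hy'.
  move=> /= [? ? ?]; subst b' c' d'.
  by move: hy hy' => /eqP <- /eqP <-.
move=> [a [b c]]; apply/allpairsPdep/allpairsPdep.
  move=> [[a1 s] [[b1 c1] [hs hbc [? ? ?]]]]; subst a1 b1 c1.
  exists ((a `+` b)%mset, c), (a, b); rewrite !mem_msplits /= in hs hbc *.
  by split=> //; rewrite -msetDA (eqP hbc).
move=> [[s c1] [[a1 b1] [hs hab [? ? ?]]]]; subst a1 b1 c1.
exists (a, (b `+` c)%mset), (b, c); rewrite !mem_msplits /= in hs hab *.
by split=> //; rewrite msetDA (eqP hab).
Qed.

Fact fps_mul1l : left_id fps_one fps_mul.
Proof.
move=> f; apply/funext => m; rewrite /fps_mul.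
rewrite (bigD1_seq (mset0, m)) ?mem_msplits ?msplits_uniq //= ?mset0D //.
rewrite /fps_one eqxx mul1r big1_seq ?addr0 // => -[a b] /andP [ne].
rewrite mem_msplits /= => /eqP abm; case: eqP => [a0|]; last by rewrite mul0r.
by move: ne; rewrite -abm a0 mset0D eqxx.
Qed.

Fact fps_mulDl : left_distributive fps_mul +%R.
Proof.
move=> f g h; apply/funext => m; rewrite /fps_mul.
rewrite [RHS]/GRing.add /= -big_split /=; apply: eq_bigr => p _.
by rewrite -mulrDl.
Qed.

Fact fps_one_neq0 : fps_one != 0.
Proof.
apply/eqP => /(congr1 (fun f : fps R => f mset0)); rewrite /fps_one eqxx.
by move/eqP; rewrite oner_eq0.
Qed.

HB.instance Definition _ := GRing.Zmodule_isComNzRing.Build (fps R)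
  fps_mulA fps_mulC fps_mul1l fps_mulDl fps_one_neq0.

Fact fps_scaleAl (a : R) f g : a *: (f * g) = (a *: f) * g.
Proof.
apply/funext => m; rewrite [LHS]mulr_sumr.
by apply: eq_bigr => p _; rewrite mulrA.
Qed.

HB.instance Definition _ := GRing.Lmodule_isLalgebra.Build R (fps R) fps_scaleAl.
HB.instance Definition _ := GRing.Lalgebra_isComAlgebra.Build R (fps R).

End PowerSeriesRing.

Definition Qq := {fraction {poly rat}}.
Definition q : Qq := tofrac 'X.

Lemma q_neq1 : q - 1 != 0.
Proof.
rewrite /q -tofrac1 -tofracB tofrac_eq0 -polyC1.
by rewrite -size_poly_eq0 size_XsubC.
Qed.

Definition monomial_of (V : finType) (g : V -> nat) : monomial :=
  seq_mset (codom g).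

(* The formal sum of q ^ stat g * prod_v x_(g v) over all g : V -> nat such   *)
(* that P g. Only the finitely many g with values in the support of m can    *)
(* contribute to the coefficient of m.                                       *)
Definition filling_sum (V : finType) (P : (V -> nat) -> bool)
    (stat : (V -> nat) -> nat) : fps Qq :=
  fun m => \sum_(g : {ffun V -> finsupp m} |
                 (monomial_of (val \o g) == m) && P (val \o g))
             q ^+ stat (val \o g).

(* A vertical strip is the sequence of the contents of its cells, listed     *)
(* from top to bottom.                                                       *)
Definition is_vstrip (s : seq int) : bool :=
  (s != [::]) && sorted (fun c c' => c' == c + 1) s.

Section StripsLLT.

Variable nu : seq (seq int).

Definition cell :=
  {m : 'I_(size nu) & 'I_(size (nth [::] nu m))}.

Definition content (a : cell) : int := nth 0 (nth [::] nu (tag a)) (tagged a).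

(* The strips are numbered from 1 in the definition of shifted contents. *)
Definition shifted_content (a : cell) : int :=
  (size nu)%:Z * content a + (tag a).+1%:Z.

Definition admissible (T : cell -> nat) : bool :=
  [forall a : cell, forall b : cell,
    (tag a == tag b) && (content a < content b) ==> (T b < T a)%N].

Definition inv (T : cell -> nat) : nat :=
  #|[set p : cell * cell |
      (0 < shifted_content p.2 - shifted_content p.1 < (size nu)%:Z)
      && (T p.2 < T p.1)%N]|.

Definition LLT : fps Qq := filling_sum admissible inv.

End StripsLLT.

Section Cumulant.

Variable n : nat.

Implicit Types (B C : {set 'I_n}) (pi : {set {set 'I_n}}).

Definition unicellular_inv B (g : {a : 'I_n | a \in B} -> nat) : nat :=
  #|[set p : {a : 'I_n | a \in B} * {a : 'I_n | a \in B} |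
      (val p.1 < val p.2)%N && (g p.2 < g p.1)%N]|.

Definition unicellular_LLT B : fps Qq :=
  filling_sum xpredT (@unicellular_inv B).

Definition is_cumulant (k : {set 'I_n} -> fps Qq) : Prop :=
  forall B, B != set0 ->
    unicellular_LLT B =
      \sum_(pi | partition pi B)
        (q - 1) ^+ (#|B| - #|pi|) *: \prod_(C in pi) k C.

(* The defining relation solved for the term of the one-block partition; the *)
(* first argument bounds the depth of the recursion.                         *)
Fixpoint kappa_rec (d : nat) B : fps Qq :=
  if d is d'.+1 then
    ((q - 1) ^+ #|B|.-1)^-1 *:
      (unicellular_LLT B -
       \sum_(pi | partition pi B && (pi != [set B]))
         (q - 1) ^+ (#|B| - #|pi|) *: \prod_(C in pi) kappa_rec d' C)
  else 0.

Definition kappa B : fps Qq := kappa_rec #|B| B.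

Lemma partition1 B : B != set0 -> partition [set B] B.
Proof.
move=> B0; rewrite /partition /cover big_set1 eqxx trivIset1 inE.
by rewrite eq_sym.
Qed.

Lemma card_block pi B C :
  partition pi B -> pi != [set B] -> C \in pi -> (0 < #|C| < #|B|)%N.
Proof.
move=> parB neq Cpi; have /and3P [/eqP covB triv pi0] := parB.
have C0 : C != set0 by apply: contraNneq pi0 => <-.
have sCB : C \subset B by rewrite -covB bigcup_sup.
rewrite card_gt0 C0 /= proper_card // properEneq sCB andbT.
apply: contraNneq neq => eCB; subst C.
apply/eqP/setP => D; rewrite inE; apply/idP/eqP => [Dpi | -> //].
apply/eqP; apply/negPn/negP => neDB.
have /trivIsetP /(_ D B Dpi Cpi neDB) := triv.
have sDB : D \subset B by rewrite -covB bigcup_sup.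
rewrite -setI_eq0 (setIidPl sDB) => /eqP D0.
by rewrite -D0 Dpi in pi0.
Qed.

Lemma kappa_rec_stable d B : (0 < #|B| <= d)%N -> kappa_rec d B = kappa B.
Proof.
rewrite /kappa; elim/ltn_ind: d B => -[|d] IH B /andP [B0 leBd].
  by case: #|B| B0 leBd.
case E: #|B| B0 leBd => [//|b] _; rewrite ltnS => lebd /=.
congr (_ *: (_ - _)); apply: eq_bigr => pi /andP [parB neq].
congr (_ *: _); apply: eq_bigr => C Cpi.
have /andP [C0 ltCB] := card_block parB neq Cpi.
rewrite E ltnS in ltCB.
rewrite (IH d) ?(IH b) ?ltnS ?C0 //.
exact: leq_trans lebd.
Qed.

Lemma cumulant_rel (k : {set 'I_n} -> fps Qq) B : B != set0 ->
  \sum_(pi | partition pi B) (q - 1) ^+ (#|B| - #|pi|) *: \prod_(C in pi) k C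
  = (q - 1) ^+ #|B|.-1 *: k B +
    \sum_(pi | partition pi B && (pi != [set B]))
      (q - 1) ^+ (#|B| - #|pi|) *: \prod_(C in pi) k C.
Proof.
move=> B0; rewrite (bigD1 [set B]) ?partition1 //=.
by rewrite cards1 subn1 big_set1.
Qed.

Lemma kappa_cumulant : is_cumulant kappa.
Proof.
move=> B B0; rewrite cumulant_rel //.
have cB : (0 < #|B|)%N by rewrite card_gt0.
have -> : kappa B = kappa_rec #|B|.-1.+1 B by rewrite prednK.
rewrite /= scalerA mulfV ?expf_neq0 ?q_neq1 //.
rewrite scale1r; set S := (X in _ - X); set S' := (X in _ + X).
suff -> : S = S' by rewrite subrK.
apply: eq_bigr => pi /andP [parB neq]; congr (_ *: _).
apply: eq_bigr => C Cpi; have /andP [C0 ltCB] := card_block parB neq Cpi.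
by rewrite kappa_rec_stable // C0 -ltnS prednK.
Qed.

Lemma cumulant_unique k : is_cumulant k ->
  forall B, B != set0 -> k B = kappa B.
Proof.
move=> hk B; have [c] := ubnP #|B|; elim: c B => // c IH B; rewrite ltnS => leBc B0.
have := hk B B0; rewrite (kappa_cumulant B0) !cumulant_rel //.
set S := (X in _ + X = _); set S' := (X in _ = _ + X).
have -> : S = S'.
  apply: eq_bigr => pi /andP [parB neq]; congr (_ *: _).
  apply: eq_bigr => C Cpi; have /andP [C0 ltCB] := card_block parB neq Cpi.
  by rewrite IH // -?card_gt0 // (leq_trans ltCB).
move=> /addIr e; apply: (scalerI (a := (q - 1) ^+ #|B|.-1)).
  by rewrite expf_neq0 ?q_neq1.
by rewrite e.
Qed.

End Cumulant.

Definition kappa_D (n : nat) : fps Qq := kappa [set: 'I_n].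

Section Trees.

Variable n : nat.

(* A graph on the vertex set 'I_n is given by its set of edges; the vertex   *)
(* i : 'I_n has label i + 1.                                                 *)
Implicit Types (T : {set {set 'I_n}}) (r v : 'I_n).

Definition adj T : rel 'I_n := [rel u v | [set u; v] \in T].

Definition simple_graph T : bool := [forall e in T, #|e| == 2].

Definition connected T : bool := [forall u, forall v, connect (adj T) u v].

Definition acyclic T : bool :=
  ~~ [exists k : 'I_n.+1, exists c : k.-tuple 'I_n,
        (2 < k)%N && ucycleb (adj T) c].

Definition is_tree T : bool := [&& simple_graph T, connected T & acyclic T].

(* Length of a shortest path from r to v (and n if there is no path). *)
Definition dist T r v : nat :=
  find (fun k : nat => [exists p : k.-tuple 'I_n,
                   path (adj T) r p && (last r p == v)]) (iota 0 n).

(* Children in the tree rooted at r, by increasing label. *)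
Definition children T r v : seq 'I_n :=
  [seq u <- enum 'I_n | adj T v u && (dist T r u == (dist T r v).+1)].

(* In descend and strips_from, d only bounds the number of recursive calls. *)
Fixpoint descend T r (d : nat) v : seq 'I_n :=
  v :: (if (d, children T r v) is (d'.+1, u :: _) then descend T r d' u
        else [::]).

(* The unvisited children of the visited vertices, those of the most         *)
(* recently visited vertex first, where vis lists the visited vertices in    *)
(* the order of their visit.                                                 *)
Definition unvisited T r (vis : seq 'I_n) : seq 'I_n :=
  [seq u <- flatten [seq children T r v | v <- rev vis] | u \notin vis].

Fixpoint strips_from T r (d : nat) (vis : seq 'I_n) : seq (seq 'I_n) :=
  if (d, unvisited T r vis) is (d'.+1, u :: _) then
    descend T r n u :: strips_from T r d' (vis ++ descend T r n u)
  else [::].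

Definition tree_strips T r : seq (seq 'I_n) :=
  descend T r n r :: strips_from T r n (descend T r n r).

Definition nu T r : seq (seq int) :=
  [seq [seq (dist T r v)%:Z | v <- s] | s <- tree_strips T r].

Lemma nu_vstrips T r : all is_vstrip (nu T r).
Proof.
have descendP d v : is_vstrip [seq (dist T r w)%:Z | w <- descend T r d v].
  elim: d v => [|d IH] v //=; case E: (children T r v) => [|u s] //=.
  have : u \in children T r v by rewrite E mem_head.
  rewrite mem_filter => /andP [/andP [_ /eqP distu] _]; have := IH u.
  have -> : descend T r d u = u :: behead (descend T r d u) by case: (d).
  by rewrite /is_vstrip /= => ->; rewrite distu -addn1 PoszD eqxx.
rewrite /nu /tree_strips /= descendP /=; move: (descend T r n r).
have stripsP d vis :
    all is_vstrip [seq [seq (dist T r w)%:Z | w <- s] | s <- strips_from T r d vis].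
  elim: d vis => [|d IH] vis //=.
  by case: (unvisited T r vis) => [//|u s] /=; rewrite descendP IH.
exact: stripsP.
Qed.

End Trees.

Variant step := North | East | Diag.

Definition step_eqb (s t : step) : bool :=
  match s, t with North, North | East, East | Diag, Diag => true | _, _ => false end.

Lemma step_eqP : Equality.axiom step_eqb.
Proof. by case; case; constructor. Qed.

HB.instance Definition _ := hasDecEq.Build step step_eqP.

(* The steps of a lattice path together with their starting points. *)
Fixpoint located (x y : nat) (P : seq step) : seq (nat * nat * step) :=
  if P is s :: P' then
    (x, y, s) :: located (x + (s != North))%N (y + (s != East))%N P'
  else [::].

Section SchroederLLT.

Variables (n : nat) (P : seq step).

Definition steps := located 0 0 P.

(* Boxes are numbered from 0: the lower-left corner of the box (i, j) is the *)
(* point (i, j).                                                             *)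
Definition has_dstep (i j : nat) : bool := (i, j, Diag) \in steps.

(* The north steps apart, exactly one step of P crosses the column i. The    *)
(* whole box is weakly below P iff this step starts at least at the height   *)
(* j + 1 of the upper edge; so a box containing a diagonal step is excluded. *)
Definition box_below (i j : nat) : bool :=
  has (fun t => [&& t.1.1 == i, t.2 != North & (j < t.1.2)%N]) steps.

Definition schroeder_adm (g : 'I_n -> nat) : bool :=
  [forall i : 'I_n, forall j : 'I_n, has_dstep i j ==> (g j < g i)%N].

Definition schroeder_inv (g : 'I_n -> nat) : nat :=
  #|[set p : 'I_n * 'I_n |
      [&& (p.1 < p.2)%N, box_below p.1 p.2 & (g p.2 < g p.1)%N]]|.

Definition LLT_mu : fps Qq := filling_sum schroeder_adm schroeder_inv.

End SchroederLLT.

(* Cars and parking spots are numbered from 0. *)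
Definition parking (m : nat) (f : {ffun 'I_m -> 'I_m}) : bool :=
  [forall i : 'I_m, (i < #|[set c | (f c <= i)%N]|)%N].

Definition dyck_of (m : nat) (f : {ffun 'I_m -> 'I_m}) : seq step :=
  flatten [seq rcons (nseq #|[set c | f c == i]| North) East | i <- enum 'I_m].

Fixpoint contract (P : seq step) : seq step :=
  match P with
  | East :: North :: P' => Diag :: contract P'
  | s :: P' => s :: contract P'
  | [::] => [::]
  end.

Definition parking_path (m : nat) (f : {ffun 'I_m -> 'I_m}) : seq step :=
  contract [:: North, East & dyck_of f].

(* Main.v *)
(** Fix a word [u] of values. Exploring a graph on its letters breadth first, by *)
(** a queue whose head [v] leaves while a set of [b] undiscovered letters enters, *)
(** gives a weight: the first letter that enters must be smaller than [v], and    *)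
(** [v] contributes [q] for every smaller letter left in the queue. If each entry *)
(** is moreover weighted by [q - 1] and the exploration may restart when the      *)
(** queue is empty, the weights add up to the inversion generating function of    *)
(** all words with the given content: for one step this is the identity           *)
(** [sum_u q^inv(u) (q^#{u_j < v} - 1) = (q^m - 1) sum_(u_1 < v) q^inv(u)].       *)
(** Cutting at the first time the queue is empty gives exactly the recursion that *)
(** defines the cumulant. The sets that enter at the successive steps are the     *)
(** fibres of a parking function, and also the sets of children in a Cayley tree  *)
(** listed breadth first; reading the cells of the strips by shifted content is   *)
(** this breadth-first order.                                                     *)

Require Import Defs.
From mathcomp Require Import all_boot all_order all_algebra.
From mathcomp Require Import zify ring.
From mathcomp Require Import finmap multiset boolp.

Set Implicit Arguments.
Unset Strict Implicit.
Unset Printing Implicit Defensive.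

Import Order.TTheory GRing.Theory Num.Theory.

Local Open Scope ring_scope.

(** * Inversions of words with a given content *)

(** The cumulant, the tree sum and the parking sum are compared through [LLT_trees n], whose
    coefficients are sums over words of the exploration weight [psi q 1].

    For the cumulant, let [v] leave the queue while [m] letters are undiscovered. By the binomial
    theorem the nonempty entering sets weigh [q^m - 1] in total, on words whose undiscovered part
    starts below [v]; [wsum_head_below] turns this into the inversions between [v] and the
    undiscovered letters, so the weights [omega] add up to [q^winv] ([omega_sum]). The identity is
    an instance of the q-multinomial recursion [invgf_rem]. Cutting at the first empty queue
    ([omega_expand]) yields [LLT_complete_rec], where the binomial coefficient counts the possible
    blocks of a fixed element. Iterating gives [LLT_complete_partitions], the defining relation of
    the cumulant, and uniqueness gives [kappa_D_trees].

    For parking functions, record how many letters enter at each step. The multinomial coefficients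
    count the maps with these fibre sizes ([psi_csum], [sum_counts]), and the weight of one record
    is read off the path ([pfw_closed_form]): a queue that never empties too early is the parking
    condition, the constraint on the first entering letter is a diagonal step, and the letters left
    in the queue are the boxes below the path. This is [sum_LLT_mu].

    For trees, depth-first construction of the strips forces the order by shifted content to be
    breadth first ([tree_bfs_ranking]). Sending a vertex to the rank of its parent is then a
    bijection onto parking functions ([sum_trees_parking]) that preserves the LLT polynomial of each
    tree ([LLT_tree]). *)

Lemma mem_rem_neq (T : eqType) (x y : T) s : x != y -> x \in s -> x \in rem y s.
Proof.
move=> ne xs; have [ys | /rem_id -> //] := boolP (y \in s).
by move: xs; rewrite (perm_mem (perm_to_rem ys)) inE (negPf ne).
Qed.

Section Words.

Variables (R : comNzRingType) (t : R).
Implicit Types (s u w : seq nat) (v x y : nat).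

Definition below v s : nat := count (fun y => y < v)%N s.

Fixpoint winv u : nat :=
  if u is v :: u' then (below v u' + winv u')%N else 0%N.

Lemma below_cat v s w : below v (s ++ w) = (below v s + below v w)%N.
Proof. exact: count_cat. Qed.

Lemma below_perm v s w : perm_eq s w -> below v s = below v w.
Proof. by move=> /permP; apply. Qed.

Definition cross s w : nat := sumn [seq below v w | v <- s].

Lemma winv_cat s w : winv (s ++ w) = (winv s + cross s w + winv w)%N.
Proof. by elim: s => //= v s ->; rewrite below_cat /cross /=; lia. Qed.

Lemma cross_perm s w w' : perm_eq w w' -> cross s w = cross s w'.
Proof. by move=> p; congr sumn; apply: eq_map => v; apply: below_perm. Qed.

Definition wsum s (F : seq nat -> R) : R := \sum_(u <- permutations s) F u.

Lemma eq_wsum s F G : (forall u, perm_eq u s -> F u = G u) -> wsum s F = wsum s G.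
Proof.
by move=> e; apply: eq_big_seq => u; rewrite mem_permutations => /e.
Qed.

Lemma perm_wsum s w F : perm_eq s w -> wsum s F = wsum w F.
Proof. by move=> p; apply: perm_big; apply: perm_permutations. Qed.

Lemma wsum_nil F : wsum [::] F = F [::].
Proof. by rewrite /wsum big_seq1. Qed.

Lemma wsum_cons s F : s != [::] ->
  wsum s F = \sum_(x <- undup s) wsum (rem x s) (fun u => F (x :: u)).
Proof.
move=> s0; rewrite /wsum (perm_big _ (permutationsE _)) ?lt0n ?size_eq0 //.
by rewrite big_allpairs_dep.
Qed.

Lemma wsum_distrl s F c : c * wsum s F = wsum s (fun u => c * F u).
Proof. exact: mulr_sumr. Qed.

Lemma wsum_sum s (I : Type) (r : seq I) (F : I -> seq nat -> R) :
  wsum s (fun u => \sum_(i <- r) F i u) = \sum_(i <- r) wsum s (F i).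
Proof. exact: exchange_big. Qed.

Definition invgf s : R := wsum s (fun u => t ^+ winv u).

Lemma invgf_cons s : s != [::] ->
  invgf s = \sum_(x <- undup s) t ^+ below x s * invgf (rem x s).
Proof.
move=> s0; rewrite /invgf wsum_cons //; apply: eq_big_seq => x.
rewrite mem_undup => xs; rewrite wsum_distrl; apply: eq_wsum => u pu /=.
rewrite exprD; congr (t ^+ _ * _); rewrite (below_perm _ pu).
by rewrite (below_perm _ (perm_to_rem xs)) /below /= ltnn.
Qed.

(** The term of [x] is [t ^ below x.+1 s - t ^ below x s], and it vanishes for values that do not
    occur in [s], so the sum may run over all [x < v] and telescopes. *)
Lemma telescope_below s v :
  \sum_(x <- undup s | (x < v)%N) t ^+ below x s * (t ^+ count_mem x s - 1) =
  t ^+ below v s - 1.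
Proof.
transitivity (\sum_(0 <= x < v) t ^+ below x s * (t ^+ count_mem x s - 1)).
  rewrite [RHS](bigID (fun x => x \in s)) /= [X in _ + X]big1 ?addr0; last first.
    by move=> x /count_memPn ->; rewrite subrr mulr0.
  rewrite -big_filter -[RHS]big_filter; apply/perm_big/uniq_perm.
  - exact/filter_uniq/undup_uniq.
  - exact/filter_uniq/iota_uniq.
  by move=> x; rewrite !mem_filter mem_undup mem_iota subn0 add0n andbC.
under eq_bigr => x _.
  rewrite mulrBr mulr1 -exprD.
  have -> : (below x s + count_mem x s)%N = below x.+1 s.
    rewrite /below; elim: (s) => //= y s' <-; case: ltngtP => /=; lia.
  over.
by rewrite telescope_sumr // {2}/below (eq_count (a2 := pred0)) // count_pred0.
Qed.

(** This is the recursion of q-multinomial coefficients, stated without division. Expand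
    [t ^ size s - 1] by [telescope_below] and [invgf s] by its first letter, and compare the terms
    of each letter [y]. *)
Lemma invgf_rem s x : x \in s ->
  (t ^+ size s - 1) * invgf (rem x s) = (t ^+ count_mem x s - 1) * invgf s.
Proof.
have [n] := ubnP (size s); elim: n s x => // n IH s x; rewrite ltnS => les xs.
have s0 : s != [::] by case: (s) xs.
have -> : t ^+ size s - 1 =
    \sum_(y <- undup s) t ^+ below y s * (t ^+ count_mem y s - 1).
  pose B := (\max_(y <- s) y)%N.+1.
  have hB y : y \in s -> (y < B)%N.
    by move=> ys; rewrite ltnS; exact: (@leq_bigmax_seq _ s xpredT id y ys).
  have -> : size s = below B s.
    by apply/esym/eqP; rewrite -all_count; apply/allP.
  rewrite -telescope_below big_seq_cond [RHS]big_seq.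
  by apply: eq_bigl => y; rewrite mem_undup; case E: (y \in s); rewrite //= hB.
rewrite (invgf_cons s0) mulr_suml mulr_sumr; apply: eq_big_seq => y.
rewrite mem_undup => ys; rewrite -mulrA [RHS]mulrCA; congr (_ * _).
(* For [y != x], the induction hypothesis for [rem x s] and for [rem y s] reduces both sides to the
   word sum with both letters removed. *)
have [-> //|neyx] := eqVneq y x.
have sr z : z \in s -> (size (rem z s) < n)%N.
  by move=> zs; rewrite size_rem //; case: (s) zs les.
have xs' : x \in rem y s by rewrite mem_rem_neq // eq_sym.
have ys' : y \in rem x s by rewrite mem_rem_neq.
have cr a b : a \in s -> a != b -> count_mem b (rem a s) = count_mem b s.
  by move=> as' ne; rewrite (permP (perm_to_rem as')) /= (negPf ne).
rewrite -(cr x y) 1?eq_sym // -(IH _ _ (sr _ xs) ys').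
rewrite -(cr y x) // -(IH _ _ (sr _ ys) xs') !size_rem //.
congr (_ * _); apply: perm_wsum.
apply/permP => a.
have := (permP (perm_to_rem xs) a, permP (perm_to_rem ys) a).
by case; have := (permP (perm_to_rem ys') a, permP (perm_to_rem xs') a) => -[] /=; lia.
Qed.

(** Since [below v] is constant on rearrangements, the left side is [(t ^ below v s - 1) * invgf s].
    Telescoping splits it over the letters [x < v], and [invgf_rem] makes the part of [x] the sum
    over the words that start with [x]. *)
Lemma wsum_head_below s v :
  wsum s (fun u => t ^+ winv u * (t ^+ below v u - 1)) =
  (t ^+ size s - 1) *
    wsum s (fun u => (head 0%N u < v)%N%:R * t ^+ winv u).
Proof.
transitivity ((t ^+ below v s - 1) * invgf s).
  rewrite wsum_distrl; apply: eq_wsum => u pu.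
  by rewrite mulrC (below_perm _ pu).
have [-> | s0] := eqVneq s [::]; first by rewrite /below /= subrr !mul0r.
rewrite [in RHS]wsum_cons // [RHS]mulr_sumr -(telescope_below s v).
rewrite [LHS]mulr_suml big_mkcond /=.
apply: eq_big_seq => x; rewrite mem_undup => xs.
rewrite -wsum_distrl; case: ifP => xv; last by rewrite mul0r mulr0.
rewrite mul1r -mulrA -invgf_rem // mulrCA; congr (_ * _).
rewrite /invgf wsum_distrl; apply: eq_wsum => u pu; rewrite -exprD.
congr (t ^+ (_ + _)); rewrite (below_perm _ (perm_to_rem xs)) (below_perm _ pu).
by rewrite /below /= ltnn.
Qed.

End Words.

(** * Breadth-first exploration of words *)

Lemma triangular_exchange (R : nzRingType) m (F : nat -> nat -> R) :
  \sum_(a < m.+1) \sum_(k < (m - a).+1) F a (a + k)%N =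
  \sum_(j < m.+1) \sum_(a < j.+1) F a j.
Proof.
transitivity (\sum_(a < m.+1) \sum_(0 <= k < (m - a).+1) F a (a + k)%N).
  by apply: eq_bigr => a _; rewrite big_mkord.
elim: m => [|m IH]; first by rewrite !big_ord1 big_nat1.
rewrite [RHS]big_ord_recr -IH big_ord_recr /= subnn big_nat1 addn0.
rewrite [X in _ = _ + X]big_ord_recr addrA; congr (_ + _) => /=.
rewrite -big_split; apply: eq_bigr => a _ /=.
have am : (a <= m)%N by rewrite -ltnS.
by rewrite subSn // big_nat_recr //= addnS subnKC.
Qed.

Section Exploration.

Variables (R : comNzRingType) (t : R).
Implicit Types (u w p s : seq nat) (a c : seq nat) (h m k v : nat).

Local Notation wsum := (@wsum R).

(** Fix the first [b] letters: [phi] is then a constant, and only the sums over arrangements of the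
    remaining letters are compared. *)
Lemma wsum_prefix s b (phi F G : seq nat -> R) :
  (b <= size s)%N ->
  (forall p w, size p = b -> size (p ++ w) = size s ->
     wsum w (fun u => F (p ++ u)) = wsum w (fun u => G (p ++ u))) ->
  wsum s (fun u => phi (take b u) * F u) = wsum s (fun u => phi (take b u) * G u).
Proof.
elim: b s phi F G => [|b IH] s phi F G bs FG.
  under eq_wsum do rewrite take0; under [in RHS]eq_wsum do rewrite take0.
  rewrite -[LHS](wsum_distrl s F) -[RHS](wsum_distrl s G).
  by congr (_ * _); apply: (FG [::]).
have s0 : s != [::] by case: (s) bs.
rewrite !wsum_cons //; apply: eq_big_seq => x; rewrite mem_undup => xs /=.
have sz : (size (rem x s)).+1 = size s by rewrite size_rem // prednK // (leq_ltn_trans _ bs).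
apply: (IH _ (fun u => phi (x :: u)) (fun u => F (x :: u)) (fun u => G (x :: u))).
  by rewrite -ltnS sz.
by move=> p w pb pw; apply: (FG (x :: p)); rewrite /= ?pb ?pw.
Qed.

(* One step of a breadth-first exploration of the word [v :: u]: the head [v] *)
(* of a queue with [h.+1] entries leaves it, and the next [b] letters enter.  *)
Definition bfs_step b v h u : R :=
  ((b == 0) || (nth 0 u h < v))%N%:R * t ^+ below v (take h u).

(* The binomial coefficient counts the sets of labels of the entering letters. *)
Fixpoint psi h u : R :=
  if u is v :: u' then
    if h is h'.+1 then
      \sum_(b < (size u' - h').+1)
         'C(size u' - h', b)%:R * bfs_step b v h' u' * psi (h' + b) u'
    else 0
  else (h == 0)%:R.

(* The variant of [psi] in which the letters that are left when the queue is *)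
(* empty are weighted by their inversions. *)
Fixpoint omega h u : R :=
  if h is h'.+1 then
    if u is v :: u' then
      \sum_(b < (size u' - h').+1)
         'C(size u' - h', b)%:R * (t - 1) ^+ b * bfs_step b v h' u' * omega (h' + b) u'
    else 0
  else t ^+ winv u.

Lemma sum_bin_pos m : \sum_(b < m) 'C(m, b.+1)%:R * (t - 1) ^+ b.+1 = t ^+ m - 1.
Proof.
rewrite -[X in X ^+ m - _](subrK 1) [t - 1 + 1]addrC exprDn big_ord_recl /= bin0 expr1n.
rewrite mul1r mulr1n [1 + _]addrC addrK; apply: eq_bigr => i _.
by rewrite expr1n mul1r mulr_natl.
Qed.

(** The queue [p] is fixed and the undiscovered letters [s] are averaged over all orders; induction
    is on the total number of letters, since each step consumes the head of the queue. *)
Lemma omega_sum p s :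
  wsum s (fun u => omega (size p) (p ++ u)) = wsum s (fun u => t ^+ winv (p ++ u)).
Proof.
have [n] := ubnP (size p + size s)%N; elim: n p s => // n IH [|v p] s; rewrite ltnS.
  by move=> _; apply: eq_wsum => -[].
move=> /= ln; set m := size s.
(* The constraint on the first entering letter depends only on the first [b] letters of [u], as
   [wsum_prefix] requires. *)
pose ent b u : R := ((b == 0) || (head 0 u < v))%N%:R.
transitivity (\sum_(b < m.+1) 'C(m, b)%:R * (t - 1) ^+ b *
    (t ^+ (below v p + winv p + cross p s) * wsum s (fun u => ent b u * t ^+ winv u))).
  transitivity (wsum s (fun u => \sum_(b < m.+1) 'C(m, b)%:R * (t - 1) ^+ b *
      (t ^+ below v p * (ent b (take b u) * omega (size p + b) (p ++ u))))).
    apply: eq_wsum => u pu; rewrite size_cat addKn (perm_size pu).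
    apply: eq_bigr => b _; rewrite /bfs_step take_size_cat // nth_cat ltnn subnn nth0.
    have -> : ent b (take b u) = ent b u by rewrite /ent; case: (nat_of_ord b); case: (u).
    rewrite -/(ent b u).
    by rewrite -!mulrA; congr (_ * (_ * _)); rewrite mulrCA.
  rewrite wsum_sum; apply: eq_bigr => b _; rewrite -!wsum_distrl; congr (_ * _).
  rewrite (@wsum_prefix s b (ent b) _ (fun u => t ^+ winv (p ++ u))).
  - rewrite -addnA exprD -mulrA; congr (_ * _); rewrite wsum_distrl.
    apply: eq_wsum => u pu; rewrite winv_cat (cross_perm _ pu) exprD mulrCA.
    by congr (_ * (_ * _)); rewrite /ent; case: (nat_of_ord b); case: (u).
  - by rewrite -ltnS.
  move=> q w qb sw.
  (* Once the prefix [q] of entering letters is fixed, it joins the queue and the induction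
     hypothesis sums over the rest. *)
  have := IH (p ++ q) w; rewrite size_cat qb.
  under eq_wsum do rewrite -catA; under [in RHS]eq_wsum do rewrite -catA.
  by apply; move: sw ln; rewrite size_cat; lia.
(* The term [b = 0] has no constraint; all terms [b > 0] share one constraint, so their coefficients
   collect to [t ^ m - 1]. *)
rewrite big_ord_recl bin0 expr0 !mul1r.
under eq_bigr => b _ do rewrite mulrCA.
rewrite -mulr_sumr -mulrDr.
rewrite -(mulr_suml _ _ _ (wsum s (fun u => (head 0 u < v)%N%:R * t ^+ winv u))).
rewrite sum_bin_pos.
have -> : wsum s (fun u => ent 0%N u * t ^+ winv u) = wsum s (fun u => t ^+ winv u).
  by apply: eq_wsum => u _; rewrite /ent mul1r.
rewrite -wsum_head_below -big_split wsum_distrl; apply: eq_wsum => u pu.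
transitivity (t ^+ (below v p + winv p + cross p s) * (t ^+ winv u * t ^+ below v u)).
  by congr (_ * _); rewrite mulrBr mulr1; exact: subrKC.
rewrite -!exprD; congr (t ^+ _).
by rewrite below_cat winv_cat (cross_perm _ pu); lia.
Qed.

(** Here [k] is the number of letters discovered before the queue is first empty: the first [h + k]
    letters carry a complete exploration, the others are weighted by their inversions. *)
Lemma omega_expand h u : (h <= size u)%N ->
  omega h u = \sum_(k < (size u - h).+1)
    'C(size u - h, k)%:R * (t - 1) ^+ k *
      (psi h (take (h + k) u) * t ^+ winv (drop (h + k) u)).
Proof.
elim: u h => [|v u IH] [|h] hu //.
- by rewrite big_ord1 /= !mul1r.
- rewrite subn0 big_ord_recl big1 /= ?addr0 ?bin0 ?mul1r //.
  by move=> i _; rewrite mul0r mulr0.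
rewrite /= subSS; set m := (size u - h)%N.
(* Of the [j] letters discovered in all, [b] enter at this step. Choosing the [b] first or the [j]
   first gives the same count, which is the identity [bin] below. *)
pose F b j := 'C(m, j)%:R * (t - 1) ^+ j * ('C(j, b)%:R * bfs_step b v h u *
   psi (h + b) (take (h + j) u) * t ^+ winv (drop (h + j) u)).
transitivity (\sum_(b < m.+1) \sum_(k < (m - b).+1) F b (b + k)%N).
  apply: eq_bigr => -[b bm] _ /=; rewrite IH; last by rewrite /m in bm; move: hu bm => /=; lia.
  rewrite (_ : size u - (h + b) = m - b)%N; last by rewrite /m; lia.
  rewrite mulr_sumr; apply: eq_bigr => -[k km] _ /=; rewrite /F addnA.
  have bin : ('C(m, b) * 'C(m - b, k) = 'C(m, b + k) * 'C(b + k, b))%N.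
    have bkm : (b + k <= m)%N by lia.
    have d1 := bin_fact (n := m) (m := b) ltac:(lia).
    have d2 := bin_fact (n := (m - b)%N) (m := k) ltac:(lia).
    have d3 := bin_fact (n := m) (m := (b + k)%N) ltac:(lia).
    have d4 := bin_fact (n := (b + k)%N) (m := b) ltac:(lia).
    rewrite addKn in d4; rewrite subnDA in d3.
    apply/eqP; rewrite -(eqn_pmul2r (fact_gt0 b)) -(eqn_pmul2r (fact_gt0 k)).
    rewrite -(eqn_pmul2r (fact_gt0 (m - b - k))); apply/eqP.
    transitivity (m`!); first by rewrite -d1 -d2; ring.
    by rewrite -d3 -d4; ring.
  have binR : 'C(m, b)%:R * 'C(m - b, k)%:R = 'C(m, b + k)%:R * 'C(b + k, b)%:R :> R.
    by rewrite -!natrM bin.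
  rewrite exprD; set A := t ^+ _; set B := psi _ _; set C := bfs_step _ _ _ _.
  transitivity (('C(m, b)%:R * 'C(m - b, k)%:R) * ((t - 1) ^+ b * (t - 1) ^+ k * C * B * A)).
    by ring.
  by rewrite binR; ring.
rewrite triangular_exchange; apply: eq_bigr => -[j jm] _ /=; rewrite /F -mulr_sumr.
congr (_ * _); rewrite -mulr_suml.
have hj : (h + j <= size u)%N by rewrite /m in jm; move: hu => /=; lia.
rewrite size_takel // addKn; congr (_ * _).
apply: eq_bigr => -[b bj] _ /=; congr (_ * _ * _); rewrite /bfs_step take_takel ?leq_addr //.
by case: b bj => [|b] bj //; rewrite nth_take //; lia.
Qed.

(** The sum of [G] over weak compositions of [m] into [k] parts with multinomial weights, hence over
    all maps from [m] points to [k] points evaluated at their fibre sizes ([sum_counts]). *)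
Fixpoint csum k m (G : seq nat -> R) : R :=
  if k is k'.+1 then
    \sum_(b < m.+1) 'C(m, b)%:R * csum k' (m - b) (fun c => G ((b : nat) :: c))
  else (m == 0)%:R * G [::].

Lemma eq_csum k m G G' : (forall c, size c = k -> G c = G' c) ->
  csum k m G = csum k m G'.
Proof.
elim: k m G G' => [|k IH] m G G' e /=; first by rewrite e.
by apply: eq_bigr => b _; congr (_ * _); apply: IH => c ck; rewrite e //= ck.
Qed.

Lemma csum_distrl k m G x : x * csum k m G = csum k m (fun c => x * G c).
Proof.
elim: k m G => [|k IH] m G /=; first by rewrite mulrCA.
by rewrite mulr_sumr; apply: eq_bigr => b _; rewrite mulrCA IH.
Qed.

Lemma csum0 k G : csum k 0 G = G (nseq k 0%N).
Proof.
elim: k G => [|k IH] G /=; first by rewrite mul1r.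
by rewrite big_ord1 /= mul1r IH.
Qed.

(** One of the [m.+1] points is set apart and [i] is its image; on the first part this is Pascal's
    rule. *)
Lemma csumS k m G :
  csum k m.+1 G = \sum_(i < k) csum k m (fun c => G (incr_nth c i)).
Proof.
elim: k m G => [|k IH] m G; first by rewrite /= mul0r big_ord0.
rewrite [RHS]big_ord_recl /= [RHS]addrC.
rewrite exchange_big /= big_ord_recl bin0 mul1r.
transitivity (csum k m.+1 (fun c => G (0%N :: c)) +
   (\sum_(i < m.+1) 'C(m, i.+1)%:R * csum k (m - i) (fun c => G (i.+1 :: c)) +
    \sum_(i < m.+1) 'C(m, i)%:R * csum k (m - i) (fun c => G (i.+1 :: c)))).
  rewrite subn0; congr (_ + _); rewrite -big_split; apply: eq_bigr => i _ /=.
  by rewrite /bump leq0n add1n binS natrD mulrDl subSS.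
rewrite addrA; congr (_ + _).
transitivity (\sum_(b < m.+2) 'C(m, b)%:R * csum k (m.+1 - b) (fun c => G ((b : nat) :: c))).
  rewrite [RHS]big_ord_recl bin0 mul1r subn0; congr (_ + _).
rewrite big_ord_recr /= bin_small // mul0r addr0; apply: eq_bigr => -[b bm] _ /=.
by rewrite subSn // IH mulr_sumr.
Qed.

(** The weight of the exploration in which the successive numbers of entering letters are listed in
    [c]. The last letter is left out of [c]: nothing can enter when it leaves. *)
Fixpoint pfw h c u : R :=
  if (h, u) is (h'.+1, v :: u') then
    if c is b :: c' then bfs_step b v h' u' * pfw (h' + b) c' u'
    else ((h' == 0) && (u' == [::]))%N%:R
  else 0.

Lemma psi_csum h u : u != [::] -> (h <= size u)%N ->
  psi h u = csum (size u).-1 (size u - h) (fun c => pfw h c u).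
Proof.
elim: u h => [//|v u IH] [|h] _ hu.
  transitivity (0 * csum (size (v :: u)).-1 (size (v :: u) - 0) (fun _ => 0)).
    by rewrite mul0r.
  by rewrite csum_distrl; apply: eq_csum => -[|b c]; rewrite mul0r.
have [u0 | u0] := eqVneq u [::].
  move: hu; rewrite u0 /=; case: h => // _.
  by rewrite big_ord1 /= /bfs_step /= !mul1r.
rewrite /= subSS -(prednK (n := size u)) ?lt0n ?size_eq0 //=.
rewrite prednK ?lt0n ?size_eq0 //; apply: eq_bigr => -[b bm] _ /=.
rewrite -mulrA IH //; last by move: hu bm => /=; lia.
by congr (_ * _); rewrite csum_distrl subnDA.
Qed.

End Exploration.

(** * Power series as sums over words *)

(** A word is a filling of a row of [k] cells, so this is a noncommutative generating function with
    its variables made to commute; products become concatenations in [word_series_mul]. *)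
Definition word_series (k : nat) (F : seq nat -> Qq) : fps Qq :=
  fun m => if size m == k then wsum m F else 0.

Lemma eq_word_series k F G : (forall u, size u = k -> F u = G u) ->
  word_series k F = word_series k G.
Proof.
move=> e; apply/funext => m; rewrite /word_series; case: eqP => // sm.
by apply: eq_wsum => u pu; rewrite e ?(perm_size pu).
Qed.

Lemma word_series_sum k (I : finType) (P : pred I) (F : I -> seq nat -> Qq) :
  \sum_(i | P i) word_series k (F i) = word_series k (fun u => \sum_(i | P i) F i u).
Proof.
apply/funext => m; rewrite /word_series.
transitivity (\sum_(i | P i) word_series k (F i) m).
  by apply: (big_morph (fun f : fps Qq => f m)).
rewrite /word_series; case: eqP => _; last by rewrite big1.
by rewrite /wsum exchange_big.
Qed.

Lemma word_series_scale k (c : Qq) F :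
  c *: word_series k F = word_series k (fun u => c * F u).
Proof.
apply/funext => m; rewrite /word_series [LHS]/GRing.scale /=.
by rewrite /word_series; case: eqP => _; [apply: wsum_distrl | apply: mulr0].
Qed.

Lemma enum_msetD (A B : monomial) : perm_eq (A `+` B)%mset (A ++ B).
Proof.
by apply/allP => a _ /=; rewrite count_cat !count_mem_mset msetE2.
Qed.

(** A word of length [k + l] and content [m] splits uniquely into a prefix and a suffix, and their
    contents form a splitting of the monomial [m]. *)
Lemma word_series_mul (k l : nat) F G :
  word_series k F * word_series l G =
  word_series (k + l)%N (fun u => F (take k u) * G (drop k u)).
Proof.
apply/funext => m; rewrite [LHS]/GRing.mul /= /fps_mul /word_series.
case: eqP => sm; last first.
  rewrite big_seq big1 // => -[a b]; rewrite mem_msplits => /eqP /= abm.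
  case: eqP => sa; last by rewrite mul0r.
  case: eqP => sb; last by rewrite mulr0.
  by case: sm; rewrite -abm (perm_size (enum_msetD _ _)) size_cat sa sb.
pose r := [seq p : monomial * monomial <- msplits m | size p.1 == k].
pose cats (p : monomial * monomial) :=
  [seq u1 ++ u2 | u1 <- permutations p.1, u2 <- permutations p.2].
pose s := [seq u | p <- r, u <- cats p].
have mem_r (p : monomial * monomial) : p \in r -> size p.1 = k /\ (p.1 `+` p.2)%mset = m.
  by rewrite mem_filter mem_msplits => /andP [/eqP -> /eqP ->].
have mem_s (p : monomial * monomial) u : p \in r -> u \in cats p ->
    perm_eq (take k u) p.1 /\ perm_eq (drop k u) p.2.
  move=> /mem_r [pk _] /allpairsP [[u1 u2] [/=]]; rewrite !mem_permutations.
  move=> h1 h2 ->; rewrite take_size_cat ?drop_size_cat //.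
    by rewrite (perm_size h1).
  by rewrite (perm_size h1).
transitivity (\sum_(u <- s) F (take k u) * G (drop k u)); last first.
  apply/perm_big/uniq_perm; last 1 first.
  - move=> u; rewrite mem_permutations; apply/allpairsPdep/idP.
      move=> [p [v [pr hv ->]]]; have [h1 h2] := mem_s _ _ pr hv.
      rewrite -(cat_take_drop k v) (permPl (perm_cat h1 h2)).
      by have [_ <-] := mem_r _ pr; rewrite perm_sym enum_msetD.
    move=> pu; have su : size u = (k + l)%N by rewrite (perm_size pu).
    exists (seq_mset (take k u), seq_mset (drop k u)), u; split=> //.
      rewrite mem_filter (perm_size (perm_eq_seq_mset _)) /= size_takel ?su ?leq_addr //.
      rewrite eqxx mem_msplits /= -[X in _ == X]seq_mset_id; apply/eqP/msetP => x.
      by rewrite msetE2 !mset_seqE -count_cat cat_take_drop (permP pu).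
    apply/allpairsP; exists (take k u, drop k u).
    by rewrite !mem_permutations /= ![perm_eq _ (seq_mset _)]perm_sym
               !perm_eq_seq_mset cat_take_drop.
  - apply: allpairs_uniq_dep.
    + exact/filter_uniq/msplits_uniq.
    + move=> p /mem_r [pk _]; apply: allpairs_uniq; rewrite ?permutations_uniq //.
      move=> [u1 u2] [v1 v2] /allpairsP [[? ?] /= [h1 _ [? ?]]].
      move=> /allpairsP [[? ?] /= [h2 _ [? ?]]]; subst; move=> /eqP.
      rewrite !mem_permutations in h1 h2.
      by rewrite eqseq_cat ?(perm_size h1) ?(perm_size h2) // => /andP [/eqP -> /eqP ->].
    move=> [p u] [p' u'] /allpairsPdep [p0 [u0 [h1 h2 [e1 e2]]]]; subst p0 u0.
    move=> /allpairsPdep [p0 [u0 [h3 h4 [e1 e2]]]] /= e; subst p0 u0 u'.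
    have [h5 h6] := mem_s _ _ h1 h2; have [h7 h8] := mem_s _ _ h3 h4.
    suff -> : p = p' by [].
    rewrite [p]surjective_pairing [p']surjective_pairing.
    congr (_, _); rewrite -[LHS]seq_mset_id -[RHS]seq_mset_id; apply/eq_seq_msetP.
      by rewrite -(permPl h5).
    by rewrite -(permPl h6).
  exact: permutations_uniq.
rewrite big_allpairs_dep big_filter [RHS]big_mkcond /=; apply: eq_big_seq => p.
rewrite mem_msplits => /eqP pm; case: eqP => pk; last by rewrite mul0r.
have -> : size (p.2 : monomial) == l.
  by move: sm; rewrite -pm (perm_size (enum_msetD _ _)) size_cat pk => /addnI ->.
rewrite /cats big_allpairs_dep /wsum mulr_suml; apply: eq_big_seq => u1.
rewrite mem_permutations => /perm_size su1; rewrite mulr_sumr.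
by apply: eq_bigr => u2 _; rewrite take_size_cat ?drop_size_cat // su1.
Qed.

Lemma word_series0 F : word_series 0 F = F [::] *: 1.
Proof.
apply/funext => m; transitivity (F [::] * (m == mset0)%:R); last by [].
rewrite /word_series size_mset_eq0; case: eqP => [->|_]; last by rewrite mulr0.
by rewrite enum_mset0 wsum_nil mulr1.
Qed.

Lemma codom_ord n (g : 'I_n -> nat) (i : 'I_n) : nth 0%N (codom g) i = g i.
Proof.
by rewrite /codom /image_mem (nth_map i) ?size_enum_ord // nth_ord_enum.
Qed.

Lemma filling_sum_word n (P : ('I_n -> nat) -> bool) stat :
  filling_sum P stat = word_series n
    (fun u => (P (fun i => nth 0%N u i))%:R * q ^+ stat (fun i => nth 0%N u i)).
Proof.
apply/funext => m; rewrite /filling_sum /word_series.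
have monoE (g : 'I_n -> nat) : (monomial_of g == m) = perm_eq (codom g) m.
  apply/eqP/eq_seq_msetP; rewrite /monomial_of seq_mset_id //.
case: eqP => sm; last first.
  apply: big_pred0 => g; rewrite monoE; apply/negbTE/andP => -[/perm_size].
  by rewrite size_codom card_ord => /esym.
rewrite big_mkcondr /=.
pose r := [seq codom (val \o (g : {ffun 'I_n -> finsupp m})) |
  g <- enum [pred g : {ffun 'I_n -> finsupp m} | monomial_of (val \o g) == m]].
transitivity (\sum_(u <- r) (P (fun i => nth 0%N u i))%:R * q ^+ stat (fun i => nth 0%N u i)).
  rewrite big_map big_enum /=; apply: eq_bigr => g _.
  have -> : (fun i : 'I_n => nth 0%N (codom (val \o g)) i) = val \o g.
    by apply/funext => i; rewrite codom_ord.
  by case: ifP; rewrite ?mul1r ?mul0r.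
apply/perm_big/uniq_perm; last 1 first.
- move=> u; rewrite mem_permutations; apply/mapP/idP => [[g] | pu].
    by rewrite mem_enum inE monoE => ? ->.
  have su : size u = n by rewrite (perm_size pu).
  have um (i : 'I_n) : nth 0%N u i \in finsupp m.
    by rewrite msuppE -(perm_mem pu) mem_nth ?su.
  pose g := [ffun i : 'I_n => [` um i]%fset].
  have cg : codom (val \o g) = u.
    apply: (@eq_from_nth _ 0%N); rewrite size_codom card_ord ?su // => i lti.
    by rewrite (codom_ord _ (Ordinal lti)) /= ffunE.
  by exists g; rewrite ?cg // mem_enum inE monoE cg.
- rewrite map_inj_uniq ?enum_uniq // => g g' e; apply/ffunP => i; apply: val_inj.
  by rewrite -[LHS](codom_ord (val \o g)) e codom_ord.
exact: permutations_uniq.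
Qed.

Lemma filling_sum_bij (V V' : finType) (phi : V -> V') P stat P' stat' :
  bijective phi ->
  (forall g, P' g = P (g \o phi)) -> (forall g, stat' g = stat (g \o phi)) ->
  @filling_sum V P stat = @filling_sum V' P' stat'.
Proof.
move=> [psi phiK psiK] hP hs; apply/funext => m; rewrite /filling_sum.
rewrite (reindex (fun g : {ffun V' -> finsupp m} => [ffun v => g (phi v)])) /=.
  have e (g : {ffun V' -> finsupp m}) :
      val \o [ffun v => g (phi v)] = (val \o g) \o phi.
    by apply/funext => v; rewrite /= ffunE.
  apply: eq_big => [g|g _]; rewrite e ?hs // hP; congr (_ && _); congr (_ == _).
  apply/eq_seq_msetP; rewrite /codom /image_mem (map_comp (val \o g) phi).
  apply/perm_map/uniq_perm; rewrite ?enum_uniq //.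
    by rewrite map_inj_uniq ?enum_uniq //; apply: can_inj phiK.
  by move=> v; rewrite mem_enum; apply/mapP; exists (psi v); rewrite ?mem_enum ?psiK.
exists (fun g => [ffun v => g (psi v)]) => g _; apply/ffunP => v.
  by rewrite !ffunE psiK.
by rewrite !ffunE phiK.
Qed.

(** * The cumulant *)

Lemma card_pairs (V : finType) (Q : V -> V -> bool) :
  #|[set p : V * V | Q p.1 p.2]| = (\sum_(i : V) \sum_(j : V) (Q i j : nat))%N.
Proof.
rewrite -sum1_card pair_bigA /= big_mkcond /=; apply: eq_bigr => -[i j] _.
by rewrite inE /=; case: (Q i j).
Qed.

Lemma below_take_sum v h u n : size u = n ->
  below v (take h u) = (\sum_(j < n) ((j < h) && (nth 0 u j < v))%N)%N.
Proof.
move=> <-; elim: u h => [|x u IH] h; first by rewrite big_ord0.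
rewrite big_ord_recl; case: h => [|h] /=; first by rewrite big1.
by rewrite /below /= -/(below v _) IH.
Qed.

Lemma winv_sum u n : size u = n ->
  winv u = (\sum_(i < n) \sum_(j < n) ((i < j) && (nth 0 u j < nth 0 u i))%N)%N.
Proof.
move=> <-; elim: u => [|x u IH] /=; first by rewrite big_ord0.
rewrite big_ord_recl big_ord_recl /= add0n IH; congr (_ + _)%N.
  rewrite -{1}(take_size u) (below_take_sum _ _ (erefl _)).
  by apply: eq_bigr => j _; rewrite ltn_ord /bump.
by apply: eq_bigr => i _; rewrite big_ord_recl.
Qed.

Lemma enum_val_ltn n (B : {set 'I_n}) (i j : 'I_#|B|) :
  (enum_val i < enum_val j)%N = (i < j)%N.
Proof.
have srt : sorted ltn [seq val x | x <- enum B].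
  rewrite /enum_mem -enumT; apply: (subseq_sorted ltn_trans (s2 := iota 0 n)).
    by rewrite -val_enum_ord map_subseq ?filter_subseq.
  exact: iota_ltn_sorted.
have x0 : 'I_n := enum_val i.
have e (k : 'I_#|B|) : nat_of_ord (enum_val k) = nth 0%N [seq val x | x <- enum B] k.
  by rewrite (nth_map x0) -?cardE // (enum_val_nth x0).
rewrite !e; have mono := sorted_ltn_nth ltn_trans 0%N srt.
have lt_k (k : 'I_#|B|) : (k < size [seq val x | x <- enum B])%N.
  by rewrite size_map -cardE.
case: (ltngtP i j) => [ij|ji|/val_inj ->]; last by rewrite ltnn.
  by apply: mono; rewrite ?inE.
by apply/negbTE; rewrite -leqNgt ltnW //; apply: mono; rewrite ?inE.
Qed.

Definition LLT_complete b : fps Qq := word_series b (fun u => q ^+ winv u).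

(** The increasing enumeration of [B] carries its inversions to those of a word, so only the
    cardinality matters. *)
Lemma unicellular_LLT_complete n (B : {set 'I_n}) :
  unicellular_LLT B = LLT_complete #|B|.
Proof.
pose phi (i : 'I_#|B|) : {a : 'I_n | a \in B} := exist _ (enum_val i) (enum_valP i).
have phi_inj : injective phi.
  by move=> i j /(congr1 val) /= /enum_val_inj.
have phi_bij : bijective phi.
  by apply: inj_card_bij => //; rewrite card_sig card_ord.
pose stat (h : 'I_#|B| -> nat) :=
  (\sum_(i < #|B|) \sum_(j < #|B|) ((i < j) && (h j < h i))%N)%N.
rewrite /unicellular_LLT -(filling_sum_bij (P := xpredT) (stat := stat) phi_bij) //.
  rewrite filling_sum_word; apply: eq_word_series => u su.
  by rewrite mul1r (winv_sum su).
move=> g; rewrite /unicellular_inv.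
rewrite (card_pairs (fun a b : {a : 'I_n | a \in B} => (val a < val b)%N && (g b < g a)%N)).
have [psi phiK psiK] := phi_bij.
rewrite (reindex phi) /=; last by exists psi => x _; rewrite ?phiK ?psiK.
apply: eq_bigr => i _; rewrite (reindex phi) /=; last first.
  by exists psi => x _; rewrite ?phiK ?psiK.
by apply: eq_bigr => j _; rewrite enum_val_ltn.
Qed.

Definition LLT_trees b : fps Qq := word_series b (psi q 1).

(** The exploration starts with the first letter as its queue; [k] further letters are discovered
    before the queue is empty. *)
Lemma LLT_complete_rec b : LLT_complete b.+1 =
  \sum_(k < b.+1) ('C(b, k)%:R * (q - 1) ^+ k) *: (LLT_trees k.+1 * LLT_complete (b - k)).
Proof.
transitivity (word_series b.+1 (omega q 1)).
  apply/funext => m; rewrite /LLT_complete /word_series; case: eqP => // sm.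
  have m0 : m != [::] :> seq nat by rewrite -size_eq0 sm.
  (* Fixing the first letter [x] leaves exactly the situation of [omega_sum] with queue [[:: x]]. *)
  by rewrite !wsum_cons //; apply: eq_bigr => x _; apply/esym/(omega_sum q [:: x]).
under eq_bigr => k _.
  rewrite word_series_mul word_series_scale.
  rewrite addSn subnKC -1?ltnS //.
  over.
rewrite word_series_sum; apply: eq_word_series => u su.
by rewrite omega_expand su // subSS subn0.
Qed.

(** * Sums over set partitions *)

Lemma sum_subsets_with n (B : {set 'I_n}) x b (F : nat -> fps Qq) :
  x \in B -> #|B| = b.+1 ->
  \sum_(C : {set 'I_n} | (x \in C) && (C \subset B)) F #|C|.-1 =
  \sum_(k < b.+1) F k *+ 'C(b, k).
Proof.
move=> xB cB; have cBx : #|B :\ x| = b by move: cB; rewrite (cardsD1 x) xB => -[].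
rewrite (reindex_onto (fun D => x |: D) (fun C => C :\ x)) /=; last first.
  by move=> C /andP [xC _]; rewrite setD1K.
have eP D : ((x \in x |: D) && (x |: D \subset B)) && ((x |: D) :\ x == D) =
            (D \subset B :\ x).
  rewrite setU11 subUset sub1set xB /= subsetD1; congr (_ && _).
  by apply/eqP/idP => [<-|/setU1K //]; rewrite !inE eqxx.
under eq_bigl do rewrite eP.
transitivity (\sum_(D : {set 'I_n} | D \subset B :\ x) F #|D|).
  apply: eq_bigr => D; rewrite subsetD1 => /andP [_ xD].
  by rewrite cardsU1 xD.
rewrite (partition_big (fun D : {set 'I_n} => inord #|D| : 'I_b.+1) xpredT) //=.
apply: eq_bigr => k _.
transitivity (\sum_(D in [set D : {set 'I_n} | D \subset B :\ x & #|D| == k]) F k).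
  apply: eq_big => [D|D /andP [sD /eqP <-]].
    rewrite inE; case sD : (D \subset B :\ x) => //=.
    by rewrite -val_eqE /= inordK // ltnS -cBx subset_leq_card.
  by rewrite inordK // ltnS -cBx subset_leq_card.
by rewrite sumr_const cards_draws cBx.
Qed.

(** A partition of [B] amounts to the block [C] of [x] together with a partition of the complement
    of [C]. *)
Lemma sum_partitions_block (T : finType) (S : comPzSemiRingType) (B : {set T}) x
    (F : {set T} -> S) : x \in B ->
  \sum_(P | partition P B) \prod_(C in P) F C =
  \sum_(C : {set T} | (x \in C) && (C \subset B))
     F C * \sum_(P | partition P (B :\: C)) \prod_(D in P) F D.
Proof.
move=> xB; rewrite (partition_big (fun P => pblock P x)
   (fun C : {set T} => (x \in C) && (C \subset B))) /=; last first.
  move=> P parP; have xP : x \in cover P by rewrite (cover_partition parP).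
  by rewrite mem_pblock xP (partitionS parP) // pblock_mem.
apply: eq_bigr => C /andP [xC sCB].
have C0 : C != set0 by apply/set0Pn; exists x.
rewrite mulr_sumr (reindex_onto (fun P => C |: P) (fun P => P :\ C)) /=; last first.
  move=> P /andP [parP /eqP <-]; rewrite setD1K // pblock_mem //.
  by rewrite (cover_partition parP).
have eP P : (partition (C |: P) B && (pblock (C |: P) x == C)) && ((C |: P) :\ C == P) =
    partition P (B :\: C).
  apply/idP/idP => [/andP [/andP [parP _] /eqP eP] | parP].
    by rewrite -[P in partition P]eP; apply: partitionD1 => //; rewrite setU11.
  have CP : C \notin P.
    apply/negP => /(partitionS parP) /subsetP /(_ x xC).
    by rewrite inE xC.
  have dC : [disjoint C & B :\: C].
    by rewrite -setI_eq0; apply/eqP/setP => y; rewrite !inE; case: (y \in C).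
  have parP' : partition (C |: P) B.
    have -> : B = C :|: (B :\: C).
      by apply/setP => y; rewrite !inE; case: (boolP (y \in C)) => // /(subsetP sCB).
    exact: partitionU1.
  rewrite parP' setU1K // eqxx andbT /=; apply/eqP/def_pblock => //.
    by case/and3P: parP'.
  exact: setU11.
apply: eq_big => [P|P /andP [/andP [_ _] /eqP eP']]; first exact: eP.
rewrite big_setU1 //=; rewrite -eP'.
by rewrite !inE eqxx.
Qed.

Lemma prod_partition n (k : {set 'I_n} -> fps Qq) (B : {set 'I_n}) P :
  partition P B ->
  \prod_(C in P) ((q - 1) ^+ #|C|.-1 *: k C) =
  (q - 1) ^+ (#|B| - #|P|) *: \prod_(C in P) k C.
Proof.
move=> parP; rewrite scaler_prod prodrXr; congr (_ ^+ _ *: _).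
rewrite (card_partition parP) -sum1_card -sumnB.
  by apply: eq_bigr => C _; rewrite subn1.
move=> C CP; rewrite card_gt0; apply: contraTneq CP => ->.
by case/and3P: parP.
Qed.

(** In [LLT_complete_rec] the binomial coefficient counts the blocks of size [k.+1] containing [x];
    induction treats the complement of the block. *)
Lemma LLT_complete_partitions n (B : {set 'I_n}) :
  LLT_complete #|B| =
  \sum_(P | partition P B) \prod_(C in P) ((q - 1) ^+ #|C|.-1 *: LLT_trees #|C|).
Proof.
have [c] := ubnP #|B|; elim: c B => // c IH B; rewrite ltnS => leBc.
have [-> | [x xB]] := set_0Vmem B.
  rewrite (big_pred1 set0) => [|P]; last by rewrite partition_set0.
  by rewrite big_set0 cards0 /LLT_complete word_series0 scale1r.
rewrite (sum_partitions_block _ xB).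
case cB : #|B| (leBc) => [|b] lebc; first by rewrite (cards0_eq cB) inE in xB.
rewrite LLT_complete_rec.
pose F k : fps Qq := ((q - 1) ^+ k *: LLT_trees k.+1) * LLT_complete (b - k).
transitivity (\sum_(k < b.+1) F k *+ 'C(b, k)).
  apply: eq_bigr => k _; rewrite /F -scaler_nat -scalerAl scalerA //.
rewrite -(sum_subsets_with F xB cB); apply: eq_bigr => C /andP [xC sCB].
have cC : (0 < #|C|)%N by apply/card_gt0P; exists x.
have cD : #|B :\: C| = (b - #|C|.-1)%N by rewrite cardsD (setIidPr sCB) cB; lia.
rewrite /F prednK // -IH ?cD //.
by apply: leq_ltn_trans lebc; apply: leq_subr.
Qed.

Lemma kappa_D_trees n : (0 < n)%N -> kappa_D n = LLT_trees n.
Proof.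
move=> n0; rewrite /kappa_D -(@cumulant_unique n (fun B => LLT_trees #|B|)).
- by rewrite cardsT card_ord.
- move=> B B0; rewrite unicellular_LLT_complete LLT_complete_partitions.
  by apply: eq_bigr => P /prod_partition ->.
by rewrite -card_gt0 cardsT card_ord.
Qed.

(** * Parking functions and their paths *)

Definition dyck_steps (a : seq nat) : seq step :=
  flatten [seq rcons (nseq b North) East | b <- a].

Lemma contract_norths k P : contract (nseq k North ++ P) = nseq k North ++ contract P.
Proof. by elim: k => //= k ->. Qed.

(** The east step closing the previous column is kept pending: it merges with the first north step
    of the next column if there is one. Carrying it in front makes the later inductions on columns
    uniform. *)
Lemma contract_dyck_cons b a : contract (East :: dyck_steps (b :: a)) =
  (if b is b'.+1 then Diag :: nseq b' North else [:: East]) ++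
  contract (East :: dyck_steps a).
Proof.
rewrite /dyck_steps [flatten _]/= cat_rcons; case: b => [|b] //=.
by rewrite contract_norths.
Qed.

Lemma located_cat x y P P' : located x y (P ++ P') =
  located x y P ++
  located (x + count (predC1 North) P) (y + count (predC1 East) P) P'.
Proof.
elim: P x y => [|s P IH] x y /=; first by rewrite !addn0.
by rewrite IH -!addnA.
Qed.

Lemma located_norths x y k : all (fun t => t.2 == North) (located x y (nseq k North)).
Proof. by elim: k y => //= k IH y; rewrite addn0 IH. Qed.

Lemma mem_located_diag a x y i j :
  ((i, j, Diag) \in located x y (contract (East :: dyck_steps a))) =
  [&& x <= i, i < x + size a, 0 < nth 0 a (i - x)
    & j == y + sumn (take (i - x) a)]%N.
Proof.
elim: a x y => [|b a IH] x y.
  rewrite /= inE addn0 andbA (_ : (x <= i) && (i < x) = false)%N; last by lia.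
  by apply/eqP => -[].
rewrite contract_dyck_cons.
have nth_loc x' y' k : ((i, j, Diag) \in located x' y' (nseq k North)) = false.
  by apply/negP => /(allP (located_norths x' y' k)).
rewrite located_cat mem_cat; set X := (x + _)%N; set Y := (y + _)%N.
have -> : X = x.+1.
  rewrite /X; case: (b) => [|b'] /=; first by rewrite addn1.
  by rewrite count_nseq /= mul0n addn0 addn1.
have -> : Y = (y + b)%N.
  by rewrite /Y; case: (b) => [|b'] //=; rewrite count_nseq /= mul1n.
rewrite IH.
have -> : ((i, j, Diag) \in
    located x y (if b is b'.+1 then Diag :: nseq b' North else [:: East])) =
    [&& i == x, j == y & 0 < b]%N.
  case: (b) => [|b'] /=; first by rewrite inE !andbF; apply/eqP => -[].
  by rewrite inE nth_loc orbF andbT; apply/eqP/andP => [[-> ->]|[/eqP -> /eqP ->]].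
case: (ltngtP x i) => [xi|xi|<-] /=.
- by rewrite -(subnSK xi) /= addSnnS addnA.
- by [].
by rewrite subnn /= addn0 orbF andbC; case: (0 < b)%N; lia.
Qed.

(** Column [x + size a] is included, being crossed by the last pending east step, whereas
    [mem_located_diag] excludes it. *)
Lemma has_located_below a x y i j :
  has (fun t => [&& t.1.1 == i, t.2 != North & (j < t.1.2)%N])
      (located x y (contract (East :: dyck_steps a))) =
  [&& x <= i, i <= x + size a & j < y + sumn (take (i - x) a)]%N.
Proof.
elim: a x y => [|b a IH] x y.
  by rewrite /= orbF !addn0; case: (ltngtP x i).
rewrite contract_dyck_cons located_cat has_cat.
set X := (x + _)%N; set Y := (y + _)%N.
have -> : X = x.+1.
  rewrite /X; case: (b) => [|b'] /=; first by rewrite addn1.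
  by rewrite count_nseq /= mul0n addn0 addn1.
have -> : Y = (y + b)%N.
  by rewrite /Y; case: (b) => [|b'] //=; rewrite count_nseq /= mul1n.
rewrite IH.
have nth_loc x' y' k : has (fun t => [&& t.1.1 == i, t.2 != North & (j < t.1.2)%N])
    (located x' y' (nseq k North)) = false.
  apply/hasP => -[t /(allP (located_norths x' y' k)) /eqP ->].
  by rewrite andbF.
have -> : has (fun t => [&& t.1.1 == i, t.2 != North & (j < t.1.2)%N])
    (located x y (if b is b'.+1 then Diag :: nseq b' North else [:: East])) =
    ((x == i) && (j < y))%N.
  by case: (b) => [|b'] /=; rewrite ?nth_loc orbF.
case: (ltngtP x i) => [xi|xi|<-] /=.
- by rewrite -(subnSK xi) /= addSnnS addnA.
- by [].
by rewrite subnn /= addn0 orbF leq_addr.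
Qed.

Definition counts m k (f : {ffun 'I_m -> 'I_k}) : seq nat :=
  [seq #|[set c | f c == i]| | i <- enum 'I_k].

Lemma size_counts m k (f : {ffun 'I_m -> 'I_k}) : size (counts f) = k.
Proof. by rewrite size_map size_enum_ord. Qed.

Lemma nth_counts m k (f : {ffun 'I_m -> 'I_k}) (i : 'I_k) :
  nth 0%N (counts f) i = #|[set c | f c == i]|.
Proof. by rewrite (nth_map i) ?size_enum_ord // nth_ord_enum. Qed.

Lemma sumn_take_counts m k (f : {ffun 'I_m -> 'I_k}) i : (i <= k)%N ->
  sumn (take i (counts f)) = #|[set c | (f c < i)%N]|.
Proof.
elim: i => [|i IH] ik.
  rewrite take0; apply/esym/eqP; rewrite cards_eq0.
  by apply/eqP/setP => c; rewrite !inE.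
rewrite (take_nth 0%N) ?size_counts // sumn_rcons IH; last exact: ltnW.
rewrite (nth_counts f (Ordinal ik)) -cardsUI [X in (_ + X)%N](_ : _ = 0%N) ?addn0.
  by congr #|pred_of_set _|; apply/setP => c; rewrite !inE -val_eqE /= ltnS; case: ltngtP.
apply/eqP; rewrite cards_eq0; apply/eqP/setP => c; rewrite !inE -val_eqE /=.
by case: ltngtP.
Qed.

(** The height of the path over column [i]; in the exploration, the number of letters discovered
    before the letter at position [i] leaves, the initial one included. *)
Definition reach m (f : {ffun 'I_m -> 'I_m}) (i : nat) : nat :=
  #|[set c | (f c < i)%N]|.+1.

Lemma parking_path_counts m (f : {ffun 'I_m -> 'I_m}) :
  parking_path f = North :: contract (East :: dyck_steps (counts f)).
Proof. by rewrite /parking_path /dyck_of /dyck_steps /counts -map_comp. Qed.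

Lemma has_dstep_parking m (f : {ffun 'I_m -> 'I_m}) (i j : nat) :
  has_dstep (parking_path f) i j =
  [exists c, f c == i :> nat] && (j == reach f i).
Proof.
rewrite /has_dstep /steps parking_path_counts [located _ _ _]/= in_cons mem_located_diag.
rewrite (_ : (_ == _) = false) ?orFb ?subn0 ?size_counts ?add0n /=; last by apply/eqP => -[].
case: ltnP => im /=; last first.
  apply/esym/negbTE/andP => -[/existsP [c /eqP fc] _].
  by have := ltn_ord (f c); rewrite fc ltnNge im.
rewrite (nth_counts f (Ordinal im)) (sumn_take_counts f (ltnW im)); congr (_ && _).
apply/card_gt0P/existsP => -[c]; rewrite ?inE => /eqP fc; exists c; rewrite ?inE.
  by rewrite fc.
exact/eqP/val_inj.
Qed.

Lemma box_below_parking m (f : {ffun 'I_m -> 'I_m}) (i j : nat) : (i <= m)%N ->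
  box_below (parking_path f) i j = (j < reach f i)%N.
Proof.
move=> im; rewrite /box_below /steps parking_path_counts [located _ _ _]/= [has _ _]/=.
rewrite andbF orFb has_located_below subn0 size_counts !add0n im /=.
by rewrite sumn_take_counts.
Qed.

(** * Exploration weights read off the path *)

Definition wadm h (a u : seq nat) : bool :=
  all (fun i => (0 < nth 0 a i) ==> (nth 0 u (h + sumn (take i a)) < nth 0 u i))%N
    (iota 0 (size a)).

Definition wpark h (a : seq nat) : bool :=
  all (fun i => i < h + sumn (take i a))%N (iota 0 (size a).+1).

Definition winv_upto h (a u : seq nat) : nat :=
  (\sum_(i < size u) \sum_(j < size u)
     [&& i < j, j < h + sumn (take i a) & nth 0 u j < nth 0 u i])%N.

(** After [i] steps the queue occupies the positions from [i] up to [h + sumn (take i a)], excluded.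
    The three factors say that it is nonempty, that the letter entering first is smaller, and which
    inversions are counted. *)
Lemma pfw_closed_form (R : comNzRingType) (t : R) h a u :
  size u = (size a).+1 -> (h + sumn a)%N = size u ->
  pfw t h a u = (wpark h a && wadm h a u)%:R * t ^+ winv_upto h a u.
Proof.
elim: a h u => [|b a IH] [|h] [|v u] // su hu.
- move: su hu => /= -[/size0nil ->]; rewrite addn0 => -[->].
  rewrite /wpark /wadm /winv_upto /= big_ord1 /= big_ord1 /=.
  by rewrite mulr1.
- by rewrite /wpark /= mul0r.
move: su hu => /= [su] [hu].
have -> : wpark h.+1 (b :: a) = wpark (h + b) a.
  rewrite /wpark /= -[2%N]/(1 + 1)%N iotaDl all_map; congr (_ && _).
    by rewrite take0 /=; lia.
  by apply: eq_all => i; rewrite /= add1n /= addSn ltnS addnA.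
have -> : wadm h.+1 (b :: a) (v :: u) =
    ((0 < b) ==> (nth 0 u h < v))%N && wadm (h + b) a u.
  rewrite /wadm /= addn0; congr (_ && _).
  rewrite -[1%N]/(1 + 0)%N iotaDl all_map; apply: eq_all => i.
  by rewrite /= add1n /= addnA.
have -> : winv_upto h.+1 (b :: a) (v :: u) =
    (below v (take h u) + winv_upto (h + b) a u)%N.
  rewrite /winv_upto /= big_ord_recl; congr (_ + _)%N.
    rewrite big_ord_recl /= (below_take_sum _ _ (erefl _)) add0n.
    by apply: eq_bigr => j _; rewrite addn0 ltnS.
  apply: eq_bigr => i _; rewrite big_ord_recl /= add0n.
  by apply: eq_bigr => j _; rewrite /bump /= !add1n addSn !ltnS addnA.
rewrite IH //; last by rewrite -addnA.
rewrite /bfs_step exprD.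
rewrite (_ : (b == 0%N) || _ = ((0 < b) ==> (nth 0 u h < v))%N); last by case: (b).
set C := (_ ==> _).
by case: C; rewrite /= ?andbF ?mul0r // mul1r mulrCA mulrA.
Qed.

Lemma winv_upto_parking m (f : {ffun 'I_m -> 'I_m}) u : size u = m.+1 ->
  @schroeder_inv m.+1 (parking_path f) (fun i => nth 0%N u i) =
  winv_upto 1 (counts f) u.
Proof.
move=> su; rewrite /schroeder_inv (card_pairs (fun i j : 'I_m.+1 =>
  [&& i < j, box_below (parking_path f) i j & nth 0 u j < nth 0 u i])%N).
rewrite /winv_upto su; apply: eq_bigr => i _; apply: eq_bigr => j _.
have im : (i <= m)%N by rewrite -ltnS.
by rewrite box_below_parking // sumn_take_counts.
Qed.

(** The car [c] is not among those counted. This makes [reach f (f c)] a legal position among the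
    [m.+1] letters. *)
Lemma reach_leq m (f : {ffun 'I_m -> 'I_m}) c : (reach f (f c) <= m)%N.
Proof.
rewrite /reach -[X in (_ <= X)%N](card_ord m) -cardsT; apply: proper_card.
rewrite properT; apply/negP => /eqP /setP /(_ c).
by rewrite !inE ltnn.
Qed.

Lemma wadm_parking m (f : {ffun 'I_m -> 'I_m}) u : size u = m.+1 ->
  @schroeder_adm m.+1 (parking_path f) (fun i => nth 0%N u i) = wadm 1 (counts f) u.
Proof.
move=> su; rewrite /wadm size_counts; apply/forallP/allP => [adm i | adm i].
  rewrite mem_iota add0n => /= im; rewrite (nth_counts f (Ordinal im)).
  apply/implyP => /card_gt0P [c]; rewrite inE => /eqP fc.
  have rc : (reach f i < m.+1)%N by rewrite ltnS -[i]/(nat_of_ord (Ordinal im)) -fc reach_leq.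
  have /forallP /(_ (Ordinal rc)) := adm (Ordinal (ltnW im : i < m.+1)%N).
  rewrite has_dstep_parking eqxx andbT add1n (sumn_take_counts f (ltnW im)).
  by move/implyP; apply; apply/existsP; exists c; rewrite fc.
apply/forallP => j; rewrite has_dstep_parking; apply/implyP.
move=> /andP [/existsP [c /eqP fc] /eqP ->].
have im : (i < m)%N by rewrite -fc.
have := adm (f c); rewrite mem_iota add0n ltn_ord nth_counts => /(_ isT) /implyP.
rewrite (sumn_take_counts f (ltnW (ltn_ord _))) fc; apply.
by apply/card_gt0P; exists c; rewrite inE.
Qed.

Lemma wpark_parking m (f : {ffun 'I_m -> 'I_m}) : parking f = wpark 1 (counts f).
Proof.
rewrite /wpark size_counts; apply/forallP/allP => [park [|i]|park i].
- by [].
- rewrite mem_iota add0n => /= im; rewrite sumn_take_counts // add1n ltnS.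
  by have := park (Ordinal (im : i < m)%N).
have := park i.+1; rewrite mem_iota add0n ltnS ltn_ord sumn_take_counts // add1n.
by rewrite ltnS; apply.
Qed.

(** Setting car [ord0] apart increments one entry of the fibre sizes of the remaining map, which is
    the recursion [csumS]. *)
Lemma sum_counts (R : comNzRingType) m k (G : seq nat -> R) :
  \sum_(f : {ffun 'I_m -> 'I_k}) G (counts f) = csum k m G.
Proof.
elim: m G => [|m IH] G.
  rewrite csum0 (big_pred1 (ffun0 (card_ord 0) : {ffun 'I_0 -> 'I_k})).
    congr G; apply: (@eq_from_nth _ 0%N); rewrite size_counts ?size_nseq // => i ik.
    rewrite (nth_counts _ (Ordinal ik)) nth_nseq ik; apply/eqP; rewrite cards_eq0.
    by apply/eqP/setP => -[].
  by move=> f; apply/esym/eqP/ffunP => -[].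
rewrite csumS; under [RHS]eq_bigr do rewrite -IH.
rewrite pair_big /=.
pose add (p : 'I_k * {ffun 'I_m -> 'I_k}) : {ffun 'I_m.+1 -> 'I_k} :=
  [ffun c => if unlift ord0 c is Some c' then p.2 c' else p.1].
rewrite (reindex add) /=; last first.
  exists (fun f => (f ord0, [ffun c => f (lift ord0 c)])) => [[i f] _|f _].
    congr (_, _); first by rewrite ffunE unlift_none.
    by apply/ffunP => c; rewrite !ffunE liftK.
  apply/ffunP => c; rewrite !ffunE; case: unliftP => [c' ->|->] //.
  by rewrite ffunE.
apply: eq_bigr => -[i f] _ /=; congr G.
apply: (@eq_from_nth _ 0%N); rewrite size_counts ?size_incr_nth ?size_counts ?ltn_ord //.
move=> j jk; rewrite nth_incr_nth !(nth_counts _ (Ordinal jk)).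
rewrite -!sum1_card big_mkcond big_ord_recl /= inE ffunE unlift_none /=.
rewrite -val_eqE /=. rewrite [in RHS]big_mkcond; congr (_ + _)%N.
by apply: eq_bigr => c _; rewrite !inE ffunE liftK.
Qed.

Lemma sum_LLT_mu m :
  \sum_(f : {ffun 'I_m -> 'I_m} | parking f) LLT_mu m.+1 (parking_path f) = LLT_trees m.+1.
Proof.
under eq_bigr do rewrite /LLT_mu filling_sum_word.
rewrite word_series_sum; apply: eq_word_series => u su.
rewrite psi_csum ?su // -?size_eq0 ?su // subn1 -sum_counts big_mkcond /=.
apply: eq_bigr => f _; rewrite pfw_closed_form ?size_counts //; last first.
  rewrite su -[counts f]take_size size_counts sumn_take_counts // add1n; congr _.+1.
  by rewrite -[RHS](card_ord m); apply: eq_card => c; rewrite !inE ltn_ord.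
rewrite wpark_parking wadm_parking // winv_upto_parking //.
by case: (wpark _ _); rewrite ?mul0r.
Qed.

(** * Rooted trees *)

Local Open Scope nat_scope.

Section RootedTree.

Variables (n : nat) (T : {set {set 'I_n}}) (r : 'I_n).
Implicit Types (u v w x y : 'I_n).

Local Notation level := (dist T r).

Definition reach_in k v : bool :=
  [exists p : k.-tuple 'I_n, path (adj T) r p && (last r p == v)].

Lemma reach_inP k v :
  reflect (exists p, [/\ size p = k, path (adj T) r p & last r p = v]) (reach_in k v).
Proof.
apply: (iffP existsP) => [[p /andP [pp /eqP lp]] | [p [sp pp lp]]].
  by exists p; rewrite size_tuple.
by exists (tcast sp (in_tuple p)); rewrite val_tcast /= pp lp eqxx.
Qed.

Lemma reach_inS k v : reach_in k.+1 v = [exists u, reach_in k u && adj T u v].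
Proof.
apply/reach_inP/existsP => [[p] | [u /andP [/reach_inP [p [sp pp lp]] uv]]].
  case/lastP: p => [|p v'] [] //; rewrite size_rcons => -[sp].
  rewrite rcons_path last_rcons => /andP [pp lv] <-.
  by exists (last r p); rewrite lv andbT; apply/reach_inP; exists p.
by exists (rcons p v); rewrite size_rcons sp rcons_path pp last_rcons lp.
Qed.

Lemma reach_in0 v : reach_in 0 v = (v == r).
Proof.
apply/reach_inP/eqP => [[p [/size0nil -> _ <-]] // | ->].
by exists [::].
Qed.

Lemma adjC u v : adj T u v = adj T v u.
Proof. by rewrite /adj /= setUC. Qed.

Lemma level_le k v : reach_in k v -> (level v <= k).
Proof.
move=> kv; rewrite /dist leqNgt; apply/negP => klt.
have kn : (k < n).
  by apply: leq_trans klt _; rewrite -[X in _ <= X](size_iota 0 n) find_size.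
have := before_find 0 klt; rewrite nth_iota // add0n => /negbT/negP; apply.
exact: kv.
Qed.

Lemma level_root : level r = 0.
Proof. by apply/eqP; rewrite -leqn0; apply: level_le; rewrite reach_in0. Qed.

Hypothesis treeT : is_tree T.

Lemma reach_level v : (level v < n) && reach_in (level v) v.
Proof.
have /and3P [_ /forallP conn _] := treeT.
have /connectP [p pp lp] := forallP (conn r) v.
move: lp; case/shortenP: pp => q pq uq _ lq.
have sq : (size q < n).
  by have := card_uniqP uq; rewrite /= => <-; rewrite -[X in _ <= X](card_ord n) max_card.
have hq : reach_in (size q) v by apply/reach_inP; exists q; rewrite -lq.
have h : has (fun k => reach_in k v) (iota 0 n).
  by apply/hasP; exists (size q); rewrite // mem_iota add0n.
have lt : (level v < n) by move: h; rewrite has_find size_iota.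
by rewrite lt /=; have := nth_find 0 h; rewrite nth_iota.
Qed.

Lemma level_lt v : (level v < n).
Proof. by case/andP: (reach_level v). Qed.

Lemma level_eq0 v : (level v == 0) = (v == r).
Proof.
apply/eqP/eqP => [l0 | ->]; last exact: level_root.
by have /andP [_] := reach_level v; rewrite l0 reach_in0 => /eqP.
Qed.

Lemma adj_neq u v : adj T u v -> u != v.
Proof.
have /and3P [/forallP simple _ _] := treeT.
rewrite /adj /= => uv; have /implyP /(_ uv) := simple [set u; v].
by rewrite cards2; case: (u == v).
Qed.

Lemma adj_level u v : adj T u v -> level v <= (level u).+1.
Proof.
move=> uv; apply: level_le; rewrite reach_inS; apply/existsP; exists u.
by rewrite uv andbT; case/andP: (reach_level u).
Qed.

Lemma ex_parent v : v != r -> exists2 u, adj T u v & level v = (level u).+1.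
Proof.
rewrite -level_eq0; have /andP [_] := reach_level v.
case E: (level v) => [|k] //; rewrite reach_inS => /existsP [u /andP [ku uv]] _.
exists u => //; apply/eqP; rewrite eqSS eqn_leq level_le // andbT.
by rewrite -ltnS -E adj_level.
Qed.

(** Climb from [x] to the root: after [x] itself the levels are strictly below that of [v]. *)
Lemma connect_avoid v x : x != v -> level x <= level v ->
  connect [rel a b | [&& adj T a b, a != v & b != v]] r x.
Proof.
have [k] := ubnP (level x); elim: k x => // k IH x; rewrite ltnS => xk xv lxv.
have [-> | xr] := eqVneq x r; first exact: connect0.
have [u ux lx] := ex_parent xr.
have uv : u != v by apply: contraTneq lxv => <-; rewrite lx ltnn.
have luk : level u < k by rewrite -lx.
have luv : level u <= level v by rewrite ltnW // -lx.
by apply: (connect_trans (IH u luk uv luv)); apply: connect1; rewrite /= ux uv xv.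
Qed.

(* Two neighbours of [v] that are not further from the root than [v] are joined *)
(* by a path avoiding [v], which closes up to a cycle through [v]. *)
Lemma lower_neighbor_unique v u u' : adj T v u -> adj T v u' ->
  level u <= level v -> level u' <= level v -> u = u'.
Proof.
move=> vu vu' lu lu'; apply/eqP/negPn/negP => neuu'.
have /and3P [_ _ /negP acyc] := treeT; apply: acyc.
pose e := [rel a b | [&& adj T a b, a != v & b != v]].
have uv : u != v by rewrite eq_sym adj_neq.
have u'v : u' != v by rewrite eq_sym adj_neq.
have syme : connect_sym e.
  by apply: sym_connect_sym => a b; rewrite /e /= adjC [X in _ && X]andbC.
have : connect e u u'.
  apply: (connect_trans (y := r)); last exact: connect_avoid.
  by rewrite syme; apply: connect_avoid.
case/connectP => p /shortenP [q pq uq _] lq.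
have q0 : q != [::] by apply: contra_neq neuu' => q0; rewrite lq q0.
have qv : v \notin u :: q.
  rewrite inE eq_sym negb_or uv /=; move: pq; elim: (q) (u) => //= b s IHs a.
  by case/andP => /and3P [_ _ bv] /IHs; rewrite inE eq_sym negb_or bv.
have cyc : ucycle (adj T) [:: v, u & q].
  rewrite /ucycle /ucycleb [cycle _ _]/= vu rcons_path -lq adjC vu' andbT.
  rewrite (sub_path _ pq) => [|a b /and3P [] //].
  by rewrite cons_uniq qv.
have sz : size [:: v, u & q] <= n.
  rewrite -[X in _ <= X](card_ord n) -(card_uniqP _) ?max_card //.
  by case/andP: cyc.
apply/existsP; exists (inord (size [:: v, u & q])).
apply/existsP; rewrite inordK ?ltnS //; exists (in_tuple [:: v, u & q]).
by apply/andP; split; [case: (q) q0 | exact: cyc].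
Qed.

Definition parent v : 'I_n :=
  odflt r [pick u | adj T u v && (level v == (level u).+1)].

Lemma parentP v : v != r -> adj T (parent v) v /\ level v = (level (parent v)).+1.
Proof.
move=> vr; rewrite /parent; case: pickP => [u /andP [uv /eqP] // | no].
have [u uv lv] := ex_parent vr.
by have := no u; rewrite uv lv eqxx.
Qed.

Lemma parent_unique u v : adj T u v -> level u <= level v -> v != r /\ u = parent v.
Proof.
move=> uv luv; have vr : v != r.
  apply/negP => /eqP vr; move: luv; rewrite vr level_root leqn0 level_eq0 => /eqP ur.
  by have := adj_neq uv; rewrite ur vr eqxx.
split=> //; have [pv lv] := parentP vr.
by apply: (@lower_neighbor_unique v); rewrite // 1?adjC // lv.
Qed.

Lemma adj_parent u v :
  adj T u v = ((v != r) && (u == parent v)) || ((u != r) && (v == parent u)).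
Proof.
apply/idP/idP => [uv | /orP [] /andP [xr /eqP ->]].
- case: (leqP (level u) (level v)) => [luv | /ltnW luv].
    by have [-> ->] := parent_unique uv luv; rewrite eqxx.
  have vu : adj T v u by rewrite adjC.
  by have [-> ->] := parent_unique vu luv; rewrite eqxx orbT.
- by have [] := parentP xr.
by rewrite adjC; have [] := parentP xr.
Qed.

Lemma mem_children u v : (u \in children T r v) = (u != r) && (parent u == v).
Proof.
rewrite mem_filter mem_enum andbT; apply/andP/andP => [[vu /eqP lu] | [ur /eqP <-]].
  have [-> ->] : u != r /\ v = parent u by apply: parent_unique; rewrite // lu.
  by [].
by have [-> ->] := parentP ur.
Qed.

Lemma tree_edges : T = [set [set v; parent v] | v : 'I_n & v != r].
Proof.
apply/setP => e; apply/idP/imsetP => [eT | [v]]; last first.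
  by rewrite inE => vr ->; rewrite setUC; have [] := parentP vr.
have /and3P [/forallP simple _ _] := treeT.
have /cards2P [u [v [uv eE]]] := implyP (simple e) eT.
have : adj T u v by rewrite /adj /= -eE.
rewrite adj_parent => /orP [] /andP [xr /eqP p].
  by exists v; rewrite ?inE // eE setUC p.
by exists u; rewrite ?inE // eE p.
Qed.

End RootedTree.

(** * The strips of a tree *)

Lemma pairwise_mem (A : eqType) (e : rel A) s x y :
  pairwise e s -> x \in s -> y \in s -> [\/ x = y, e x y | e y x].
Proof.
move=> pw xs ys; have /(pairwiseP x) pwP := pw.
have ix : index x s \in gtn (size s) by rewrite inE index_mem.
have iy : index y s \in gtn (size s) by rewrite inE index_mem.
case: (ltngtP (index x s) (index y s)) => h.
- by constructor 2; have := pwP _ _ ix iy h; rewrite !nth_index.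
- by constructor 3; have := pwP _ _ iy ix h; rewrite !nth_index.
by constructor 1; rewrite -(nth_index x xs) h nth_index.
Qed.

Lemma filter_flatten_head (A B : eqType) (p : pred B) (F : A -> seq B) L u s :
  [seq x <- flatten [seq F a | a <- L] | p x] = u :: s ->
  exists L1 a L2 c1 c2, [/\ L = L1 ++ a :: L2, F a = c1 ++ u :: c2, p u,
    {in c1, forall x, ~~ p x} & {in L1, forall b, {in F b, forall x, ~~ p x}}].
Proof.
elim: L => //= a L IH; rewrite filter_cat.
case E: [seq x <- F a | p x] => [|u' s'] /=.
  have no x : x \in F a -> ~~ p x.
    by move=> xa; apply/negP => px; have : x \in [::] by rewrite -E mem_filter px.
  case/IH => L1 [b [L2 [c1 [c2 [-> Fb pu h1 h2]]]]].
  exists (a :: L1), b, L2, c1, c2; split=> // b'; rewrite inE => /orP [/eqP -> //|].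
  exact: h2.
case=> eu _; subst u'; exists [::], a, L.
have hu : has p (F a) by rewrite has_filter E.
exists (take (find p (F a)) (F a)), (drop (find p (F a)).+1 (F a)).
have fu : nth u (F a) (find p (F a)) = u.
  have := E; elim: (F a) => //= y c IHc; case: ifP => //= py.
  by case.
have pu : p u by rewrite -fu nth_find.
split=> //.
  by rewrite -[X in _ ++ X :: _]fu -drop_nth ?cat_take_drop // -has_find.
move=> x /(nthP u) [i]; rewrite size_takel ?find_size // => ilt <-.
by rewrite nth_take // before_find.
Qed.

Section Strips.

Variables (n : nat) (T : {set {set 'I_n}}) (r : 'I_n).
Hypothesis treeT : is_tree T.
Implicit Types (u v w x y : 'I_n).

Local Notation level := (dist T r).
Local Notation par := (parent T r).
Local Notation ch := (children T r).
Local Notation ss := (tree_strips T r).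

Let memch u v : (u \in ch v) = (u != r) && (par u == v).
Proof. exact: mem_children. Qed.

Let level_par v : v != r -> level v = (level (par v)).+1.
Proof. by move=> vr; have [] := parentP treeT vr. Qed.

Lemma children_sorted v : sorted ltn [seq val u | u <- ch v].
Proof.
apply: (subseq_sorted ltn_trans (s2 := iota 0 n)); last exact: iota_ltn_sorted.
by rewrite -val_enum_ord map_subseq ?filter_subseq.
Qed.

Lemma children_head v u s : ch v = u :: s -> forall x, x \in ch v -> (u <= x)%N.
Proof.
move=> e x; have := children_sorted v; rewrite e /=.
move=> /(order_path_min ltn_trans) /allP srt; rewrite inE => /orP [/eqP -> //| xs].
by apply/ltnW/srt/map_f.
Qed.

Lemma descend_cons d v : v \in descend T r d v.
Proof. by case: d => [|d] /=; rewrite inE eqxx. Qed.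

Lemma descend_level d v x : x \in descend T r d v -> level v <= level x.
Proof.
elim: d v => [|d IH] v /=; first by rewrite inE => /eqP ->.
case E: (ch v) => [|u s]; rewrite inE; first by move/eqP->.
move=> /orP [/eqP -> //| /IH].
have : u \in ch v by rewrite E mem_head.
by rewrite memch => /andP [ur /eqP <-]; rewrite (level_par ur) => /ltnW.
Qed.

Lemma descend_chain d v x : x \in descend T r d v -> x != v ->
  [/\ x != r, par x \in descend T r d v & exists s, ch (par x) = x :: s].
Proof.
elim: d v => [|d IH] v /=; first by rewrite inE => ->.
case E: (ch v) => [|u s]; first by rewrite inE => ->.
rewrite inE => /orP [/eqP -> | xd _]; first by rewrite eqxx.
have uch : u \in ch v by rewrite E mem_head.
have [-> | xu] := eqVneq x u.
  by move: uch; rewrite memch => /andP [-> /eqP ->]; split; [|exact: mem_head|exists s].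
by have [-> ps es] := IH _ xd xu; split=> //; rewrite inE ps orbT.
Qed.

Lemma descend_pairwise d v :
  pairwise (fun x y => level x < level y) (descend T r d v).
Proof.
elim: d v => [|d IH] v //=.
case E: (ch v) => [|u s] //=; rewrite IH andbT; apply/allP => x /descend_level.
have : u \in ch v by rewrite E mem_head.
by rewrite memch => /andP [ur /eqP <-]; rewrite (level_par ur).
Qed.

(** Levels are below [n], so under this hypothesis the bound [d] never stops the descent before a
    leaf. *)
Lemma descend_first d v x u s : n <= d + level v ->
  x \in descend T r d v -> ch x = u :: s -> u \in descend T r d v.
Proof.
elim: d v => [|d IH] v; first by have := level_lt r treeT v; rewrite add0n ltnNge => /negPf ->.
move=> nd; rewrite [descend _ _ _ _]/=; case E: (ch v) => [|u' s'].
  by rewrite inE => /eqP ->; rewrite E.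
have : u' \in ch v by rewrite E mem_head.
rewrite memch => /andP [u'r /eqP pu']; have lu' := level_par u'r.
rewrite inE => /orP [/eqP -> | xd ex].
  by rewrite E => -[<- _]; rewrite inE descend_cons orbT.
by rewrite inE (IH u') ?orbT // lu' pu' addnS.
Qed.

Lemma strips_fromP d vis i : i < size (strips_from T r d vis) ->
  exists u s, unvisited T r (vis ++ flatten (take i (strips_from T r d vis))) = u :: s
    /\ nth [::] (strips_from T r d vis) i = descend T r n u.
Proof.
elim: d vis i => [|d IH] vis i //=; case E: (unvisited T r vis) => [|u s] //=.
case: i => [|i] /=; first by exists u, s; rewrite cats0.
by rewrite ltnS catA => /IH.
Qed.

(** Each strip visits at least one new vertex, so [d] recursive calls suffice. *)
Lemma strips_from_end d vis : #|[predC vis]| <= d ->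
  unvisited T r (vis ++ flatten (strips_from T r d vis)) = [::].
Proof.
have unv u s (w : seq 'I_n) : unvisited T r w = u :: s -> u \notin w.
  move=> e; have : u \in unvisited T r w by rewrite e mem_head.
  by rewrite mem_filter => /andP [].
elim: d vis => [|d IH] vis /= hd.
  case E: (unvisited T r vis) => [|u s]; rewrite cats0 // E.
  have := unv _ _ _ E; rewrite -[_ \notin _]/(u \in [predC vis]).
  by move: hd; rewrite leqn0 => /eqP/card0_eq ->.
case E: (unvisited T r vis) => [|u s] /=; first by rewrite cats0.
rewrite catA IH // -ltnS; apply: leq_trans hd; apply: proper_card.
apply/properP; split.
  by apply/subsetP => x; rewrite !inE mem_cat negb_or => /andP [].
exists u; first by rewrite inE (unv _ _ _ E).
by rewrite !inE mem_cat descend_cons orbT.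
Qed.

Definition visited i := flatten (take i ss).
Definition start i := head r (nth [::] ss i).

Lemma nth_strips i : i < size ss ->
  nth [::] ss i = descend T r n (start i) /\
  (if i == 0 then start i = r
   else exists s, unvisited T r (visited i) = start i :: s).
Proof.
have hd d v : head r (descend T r d v) = v by case: d.
rewrite /start /visited /tree_strips; case: i => [|i] /=; first by rewrite hd.
rewrite ltnS => /strips_fromP [u [s [e1 e2]]].
by rewrite e2 hd; split=> //; exists s.
Qed.

Lemma visitedS i : i < size ss -> visited i.+1 = visited i ++ nth [::] ss i.
Proof. by move=> lti; rewrite /visited (take_nth [::]) // flatten_rcons. Qed.

Lemma unvisitedP i : 0 < i < size ss ->
  [/\ start i != r, start i \notin visited i & par (start i) \in visited i].
Proof.
case/andP => i0 /nth_strips [_]; rewrite -[i == 0]negbK -lt0n i0 /= => -[s e].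
have : start i \in unvisited T r (visited i) by rewrite e mem_head.
rewrite mem_filter => /andP [-> /flattenP [c /mapP [w]]].
by rewrite mem_rev => wv -> ; rewrite memch => /andP [-> /eqP ->].
Qed.

Lemma visited_parent i x : i <= size ss -> x \in visited i -> x != r -> par x \in visited i.
Proof.
elim: i => [|i IH] lti; first by rewrite /visited take0.
rewrite visitedS // !mem_cat => /orP [xv xr | ]; first by rewrite IH // ltnW.
have [-> hi] := nth_strips lti => xd xr.
have [xs | xs] := eqVneq x (start i); last first.
  by have [_ -> _] := descend_chain xd xs; rewrite orbT.
case: i => [|i] in IH lti hi xd xs *; first by rewrite xs hi eqxx in xr.
by rewrite xs; have [_ _ ->] := unvisitedP (i := i.+1) lti.
Qed.

(** Visited sets are closed under parents, so a visited vertex of the strip would force the start of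
    the strip to be visited already. *)
Lemma strip_notin_visited i x : i < size ss -> x \in nth [::] ss i -> x \notin visited i.
Proof.
case: i => [|i] lti; first by rewrite /visited take0.
have [-> _] := nth_strips lti; have [k] := ubnP (level x).
elim: k x => // k IH x; rewrite ltnS => lk xd.
have [-> | xs] := eqVneq x (start i.+1); first by have [] := unvisitedP (i := i.+1) lti.
have [xr pd _] := descend_chain xd xs; apply/negP => xv.
have := IH (par x); rewrite -ltnS -level_par // ltnS lk => /(_ isT pd) /negP; apply.
by apply: visited_parent xv xr; apply: ltnW.
Qed.

Lemma visited_all v : v \in visited (size ss).
Proof.
rewrite /visited take_size; have [k] := ubnP (level v).
elim: k v => // k IH v; rewrite ltnS => lk.
have [-> | vr] := eqVneq v r; first by rewrite /tree_strips /= mem_cat descend_cons.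
have pv : par v \in flatten ss by apply: IH; rewrite -level_par.
apply/negPn/negP => vn.
have e : unvisited T r (flatten ss) = [::].
  apply: strips_from_end; rewrite -[X in _ <= X](card_ord n); exact: max_card.
have : v \in unvisited T r (flatten ss); last by rewrite e.
rewrite mem_filter vn; apply/flattenP; exists (ch (par v)).
  by apply: map_f; rewrite mem_rev.
by rewrite memch vr eqxx.
Qed.

Definition strip v := find (fun s : seq 'I_n => v \in s) ss.

Lemma mem_visited i v : i <= size ss -> (v \in visited i) = (strip v < i).
Proof.
move=> lti; rewrite /strip -has_take_leq //; apply/flattenP/hasP.
  by case=> s; exists s.
by case=> s; exists s.
Qed.

Lemma strip_lt v : strip v < size ss.
Proof. by rewrite -mem_visited // visited_all. Qed.

Lemma mem_strip i v : i < size ss -> (v \in nth [::] ss i) = (strip v == i).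
Proof.
move=> lti; apply/idP/eqP => [vi | <-].
  apply/eqP; rewrite eqn_leq -ltnS -mem_visited // visitedS // mem_cat vi orbT /=.
  by rewrite leqNgt -mem_visited 1?ltnW // strip_notin_visited.
by apply: (nth_find [::] (a := fun s : seq 'I_n => v \in s)); rewrite has_find strip_lt.
Qed.

Lemma mem_descend_strip v : v \in descend T r n (start (strip v)).
Proof. by have [<- _] := nth_strips (strip_lt v); rewrite mem_strip ?strip_lt. Qed.

Lemma strip_descend i v : i < size ss -> v \in descend T r n (start i) -> strip v = i.
Proof. by move=> lti; have [<- _] := nth_strips lti; rewrite mem_strip // => /eqP. Qed.

Lemma strip_level_inj x y : strip x = strip y -> level x = level y -> x = y.
Proof.
move=> sxy lxy; have xs := mem_descend_strip x; have ys := mem_descend_strip y.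
rewrite sxy in xs.
have [//| | ] := pairwise_mem (descend_pairwise _ _) xs ys.
  by rewrite lxy ltnn.
by rewrite lxy ltnn.
Qed.

Lemma strip_first_child v u s : ch v = u :: s -> strip u = strip v.
Proof.
move=> e; apply: (strip_descend (strip_lt v)).
by apply: descend_first (mem_descend_strip v) e; apply: leq_addr.
Qed.

Lemma strip_parent x : x != r -> strip (par x) <= strip x.
Proof.
move=> xr; rewrite -ltnS -mem_visited; last exact: strip_lt.
apply: visited_parent xr; first exact: strip_lt.
by rewrite mem_visited ?strip_lt.
Qed.

Lemma strip_not_start x : x != start (strip x) ->
  [/\ x != r, strip (par x) = strip x & exists s, ch (par x) = x :: s].
Proof.
move=> xs; have [-> pd ?] := descend_chain (mem_descend_strip x) xs.
by split=> //; apply: strip_descend pd; apply: strip_lt.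
Qed.

Lemma strip_chain x y : strip x = strip y -> level y < level x ->
  [/\ x != r, strip (par x) = strip x & exists s, ch (par x) = x :: s].
Proof.
move=> sxy lyx; apply: strip_not_start; apply: contraTneq lyx => ->.
by rewrite -leqNgt sxy; apply: descend_level (mem_descend_strip y).
Qed.

Definition visit_before x y :=
  (strip x < strip y) || (strip x == strip y) && (level x < level y).

Lemma visited_pairwise i : i <= size ss -> pairwise visit_before (visited i).
Proof.
elim: i => [|i IH] lti; first by rewrite /visited take0.
rewrite visitedS // pairwise_cat IH 1?ltnW //=; apply/andP; split.
  apply/allrelP => x y; rewrite (mem_visited x (ltnW lti)) => xi.
  by rewrite mem_strip // /visit_before => /eqP ->; rewrite xi.
have [e _] := nth_strips lti; have pw := descend_pairwise n (start i).
have : {in nth [::] ss i, forall x, strip x = i}.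
  by move=> x; rewrite mem_strip // => /eqP.
rewrite e; move: pw; elim: (descend _ _ _ _) => //= x s IHs /andP [/allP a pw] h.
rewrite IHs // ?andbT => [|y ys]; last by rewrite h // inE ys orbT.
apply/allP => y ys; rewrite /visit_before !h ?inE ?eqxx ?ys ?orbT // a //.
by rewrite orbT.
Qed.

(** The new strip starts at the first entry of the unvisited list: vertices visited after its parent
    have no unvisited child left, and neither do smaller siblings remain. *)
Lemma backtrack i : 0 < i < size ss ->
  (forall x, x \in visited i -> visit_before (par (start i)) x ->
     {subset ch x <= visited i}) /\
  (forall u, u \in ch (par (start i)) -> (u < start i)%N -> u \in visited i).
Proof.
case/andP => i0 lti; have [_] := nth_strips lti.
rewrite -[i == 0]negbK -lt0n i0 /= => -[s] /filter_flatten_head.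
case=> L1 [w [L2 [c1 [c2 [eL ech _ hc1 hL1]]]]].
have sw : start i \in ch w by rewrite ech mem_cat mem_head orbT.
have /eqP -> : par (start i) == w by move: sw; rewrite memch => /andP [].
have pw := visited_pairwise (ltnW lti).
split=> [x xv wx u ux | u uch us].
  have xL1 : x \in L1.
    move: pw; rewrite -[visited i]revK eL rev_cat rev_cons cat_rcons pairwise_cat.
    case/and3P => /allrelP ab _ _; move: xv.
    rewrite -[visited i]revK eL rev_cat rev_cons cat_rcons mem_cat inE !mem_rev.
    case/or3P => [xL2 | /eqP xw |//].
      have := ab x w; rewrite mem_rev xL2 mem_head => /(_ isT isT).
      by move: wx; rewrite /visit_before; case: ltngtP => //= _; case: ltngtP.
    by move: wx; rewrite xw /visit_before !ltnn andbF.
  by have := hL1 _ xL1 _ ux; rewrite negbK.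
have : u \in c1.
  move: uch; rewrite ech mem_cat inE => /or3P [//| /eqP uE | uc2].
    by rewrite uE ltnn in us.
  have := children_sorted w; rewrite ech map_cat (sorted_pairwise ltn_trans).
  rewrite pairwise_cat /= => /and4P [_ _ /allP h _].
  by have := h _ (map_f val uc2); rewrite /= ltnNge ltnW.
by move/hc1; rewrite negbK.
Qed.

(** The depth-first property: when a strip starts at some level, all visited vertices at that level
    or deeper have been exhausted. *)
Lemma explored i u : 0 < i < size ss -> u \in visited i ->
  level (start i) <= level u -> {subset ch u <= visited i}.
Proof.
have [k] := ubnP i; elim: k i => // k IH i; rewrite ltnS => ik hi uv lu.
have [sr _ pv] := unvisitedP hi; have [after _] := backtrack hi.
have lti : i < size ss by case/andP: hi.
rewrite (level_par sr) in lu.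
case: (ltngtP (strip (par (start i))) (strip u)) => suw.
- by apply: after; rewrite // /visit_before suw.
(* Here [u] precedes the strip [j] of the parent. That strip starts no deeper than [u], so the
   children of [u] were already visited before strip [j]. *)
- set j := strip (par (start i)) in suw.
  have ji : j < i by rewrite -mem_visited // ltnW.
  have hj : 0 < j < size ss by rewrite (leq_ltn_trans _ suw) // strip_lt.
  have uj : u \in visited j by rewrite mem_visited // ltnW // strip_lt.
  have lj : level (start j) <= level u.
    apply: leq_trans (ltnW lu); exact: descend_level (mem_descend_strip _).
  move=> x /(IH j (leq_trans ji ik) hj uj lj).
  rewrite (mem_visited x (ltnW lti)) (mem_visited x (ltnW (strip_lt _))).
  by move/ltn_trans; apply.
by apply: after; rewrite // /visit_before suw eqxx lu orbT.
Qed.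

(** The strip of [w] starts no deeper than [u], so [explored] applies at its start. This is what
    makes the order by shifted content breadth first. *)
Lemma strip_child_lt u w x : level u = level w -> strip u < strip w ->
  x \in ch u -> strip x < strip w.
Proof.
move=> luw suw xu; have hw : 0 < strip w < size ss.
  by rewrite (leq_ltn_trans _ suw) // strip_lt.
have uv : u \in visited (strip w) by rewrite mem_visited // ltnW // strip_lt.
rewrite -mem_visited; last by rewrite ltnW // strip_lt.
apply: (explored hw uv _ xu); rewrite luw.
exact: descend_level (mem_descend_strip w).
Qed.

(** The larger sibling is not a first child, so it starts its own strip, and backtracking takes
    smaller children earlier. *)
Lemma strip_siblings x y : x != r -> y != r -> par x = par y -> (x < y)%N ->
  strip x < strip y.
Proof.
move=> xr yr pxy xy.
have xch : x \in ch (par y) by rewrite memch xr pxy eqxx.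
have ys : y = start (strip y).
  apply/eqP/negPn/negP => /strip_not_start [_ _ [s es]].
  by have := children_head es xch; rewrite leqNgt xy.
have hy : 0 < strip y < size ss.
  rewrite strip_lt andbT lt0n; apply/negP => /eqP s0.
  have [_] := nth_strips (strip_lt y); rewrite {1}s0 /= -ys => yE.
  by rewrite yE eqxx in yr.
have [_ sib] := backtrack hy.
rewrite -mem_visited; last by rewrite ltnW // strip_lt.
by apply: sib; rewrite -ys.
Qed.

End Strips.

(** * Breadth-first rankings *)

Lemma card_ord_lt n k : k <= n -> #|[set i : 'I_n | i < k]| = k.
Proof.
move=> kn; have winj : injective (widen_ord kn).
  by move=> i j /(congr1 val) /= /val_inj.
rewrite -[RHS]card_ord -(card_imset predT winj).
apply: eq_card => i; rewrite inE; apply/idP/imsetP => [ik | [j _ ->]].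
  by exists (Ordinal ik) => //; apply: val_inj.
exact: (ltn_ord j).
Qed.

Lemma card_rank_lt n (rho : 'I_n -> 'I_n) x :
  injective rho -> #|[set y | rho y < rho x]| = rho x.
Proof.
move=> inj; rewrite -[RHS](card_ord_lt (ltnW (ltn_ord (rho x)))).
rewrite -[RHS](card_preimset _ inj); apply: eq_card => y; by rewrite !inE.
Qed.

Section OrderRank.

Variables (V : finType) (lt : rel V).
Hypotheses (lt_irr : irreflexive lt) (lt_trans : transitive lt).
Hypothesis lt_total : forall x y, [|| x == y, lt x y | lt y x].

Definition order_rank x := #|[set y | lt y x]|.

Lemma order_rank_lt x y : (order_rank x < order_rank y) = lt x y.
Proof.
have mono a b : lt a b -> order_rank a < order_rank b.
  move=> ab; apply: proper_card; apply/properP; split.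
    by apply/subsetP => e; rewrite !inE => /lt_trans; apply.
  by exists a; rewrite !inE ?lt_irr.
apply/idP/idP => [ltxy|/mono //]; case/or3P: (lt_total x y) => [/eqP xy | // | /mono].
  by rewrite xy ltnn in ltxy.
by rewrite ltnNge ltnW.
Qed.

Lemma order_rank_max x : order_rank x < #|V|.
Proof.
rewrite -cardsT; apply: proper_card; rewrite properT.
by apply/negP => /eqP/setP/(_ x); rewrite !inE lt_irr.
Qed.

End OrderRank.

Section Ranking.

Variable m : nat.
Implicit Types (p rho : 'I_m.+1 -> 'I_m.+1) (x y : 'I_m.+1) (f : {ffun 'I_m -> 'I_m}).

(* [rho x] is the position of [x] in the breadth-first order of the tree rooted *)
(* at [ord0] with parent map [p], where siblings are ordered by their labels. *)
Definition bfs_ranking p rho : Prop :=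
  [/\ injective rho, rho ord0 = ord0, forall x, x != ord0 -> rho (p x) < rho x &
      forall x y, x != ord0 -> y != ord0 ->
        (rho x < rho y) =
        (rho (p x) < rho (p y)) || (rho (p x) == rho (p y)) && (x < y)].

Lemma bfs_ranking_pos p rho x : bfs_ranking p rho -> (0 < rho x) = (x != ord0).
Proof.
case=> inj r0 lt _; have [-> | x0] := eqVneq x ord0; first by rewrite r0.
by apply: leq_ltn_trans (lt x x0).
Qed.

(** Induction on the rank of [x]: it suffices that the same vertices precede [x] in both rankings,
    and this is decided by the ranks of parents and by labels. *)
Lemma bfs_ranking_unique p rho rho' :
  bfs_ranking p rho -> bfs_ranking p rho' -> rho =1 rho'.
Proof.
move=> R R' x; apply/esym; have [k] := ubnP (rho x).
elim: k x => // k IH x; rewrite ltnS => lk.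
have [inj r0 lt lex] := R; have [inj' r0' lt' lex'] := R'.
have [-> | x0] := eqVneq x ord0; first by rewrite r0 r0'.
have IH' z : rho z < rho x -> rho' z = rho z.
  by move=> zx; apply: IH; apply: leq_trans lk.
apply: val_inj => /=; rewrite -(card_rank_lt x inj) -(card_rank_lt x inj').
congr #|pred_of_set _|; apply/setP => y; rewrite !inE.
have [-> | y0] := eqVneq y ord0.
  by rewrite r0 r0' (bfs_ranking_pos _ R) (bfs_ranking_pos _ R').
rewrite lex // lex' // (IH' (p x)) ?lt //.
case: (ltnP (rho (p y)) (rho x)) => [/IH' -> // | pyx].
have px_py : rho (p x) < rho (p y) by apply: leq_trans pyx; apply: lt.
rewrite ![_ < rho (p x)]ltnNge ![_ == rho (p x)]eq_sym.
suff h : rho (p x) < rho' (p y).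
  by rewrite (ltnW h) (ltnW px_py) -!val_eqE /= (ltn_eqF h) (ltn_eqF px_py).
rewrite ltnNge; apply/negP => le_py.
(* If [p y] ranked too low under [rho'], the vertex [z] with that rank under [rho] would precede
   [x]; the induction hypothesis then identifies it with [p y], which does not precede [x]. *)
pose z := invF inj (rho' (p y)).
have rz : rho z = rho' (p y) by rewrite f_invF.
have zx : rho z < rho x by rewrite rz (leq_ltn_trans le_py) // lt.
have zpy : z = p y by apply: inj'; rewrite IH'.
by move: zx; rewrite zpy ltnNge pyx.
Qed.

(** The ranks of parents and the labels determine the order of the vertices, hence both rankings
    coincide, and so do the parents. This gives injectivity of the passage from trees to parking
    functions. *)
Lemma bfs_ranking_parents p rho p' rho' :
  bfs_ranking p rho -> bfs_ranking p' rho' ->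
  (forall x, x != ord0 -> rho (p x) = rho' (p' x)) ->
  forall x, x != ord0 -> p x = p' x.
Proof.
move=> R R' e; have [inj r0 lt lex] := R; have [inj' r0' lt' lex'] := R'.
suff rhoE x : rho x = rho' x by move=> x x0; apply: inj'; rewrite -rhoE e.
have [-> | x0] := eqVneq x ord0; first by rewrite r0 r0'.
apply: val_inj => /=; rewrite -(card_rank_lt x inj) -(card_rank_lt x inj').
congr #|pred_of_set _|; apply/setP => y; rewrite !inE.
have [-> | y0] := eqVneq y ord0; last by rewrite lex // lex' // !e.
by rewrite r0 r0' (bfs_ranking_pos _ R) (bfs_ranking_pos _ R').
Qed.

(** Car [c] stands for the nonroot vertex [lift ord0 c]. The default of [insubd] never occurs for a
    breadth-first ranking, by [parking_ofE]. *)
Definition parking_of p rho : {ffun 'I_m -> 'I_m} :=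
  [ffun c => insubd c (rho (p (lift ord0 c)) : nat)].

Lemma parking_ofE p rho c : bfs_ranking p rho ->
  parking_of p rho c = rho (p (lift ord0 c)) :> nat.
Proof.
case=> _ _ lt _; rewrite ffunE val_insubd ifT //.
by rewrite -ltnS; apply: leq_trans (ltn_ord (rho (lift ord0 c))); rewrite ltnS lt.
Qed.

Lemma lift0P x : x != ord0 -> exists c : 'I_m, x = lift ord0 c.
Proof. by case: (unliftP ord0 x) => [c ->|->]; [exists c | rewrite eqxx]. Qed.

Lemma reach_card p rho i : bfs_ranking p rho ->
  reach (parking_of p rho) i = #|[set y | (y == ord0) || (rho (p y) < i)]|.
Proof.
move=> R; rewrite (cardsD1 ord0) inE eqxx add1n /reach; congr _.+1.
rewrite -(card_imset _ (@lift_inj _ ord0)); apply: eq_card => y; rewrite !inE.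
apply/imsetP/andP => [[c] | [y0]].
  by rewrite inE parking_ofE // => ci ->; rewrite ci orbT.
rewrite (negPf y0) /= => yi; have [c yE] := lift0P y0.
by exists c; rewrite // inE parking_ofE // -yE.
Qed.

(** The root and the children of the vertices of rank below [i] form an initial segment of the
    ranking, whose size is the value of [reach]. *)
Lemma reachP p rho i y : bfs_ranking p rho ->
  (rho y < reach (parking_of p rho) i) = (y == ord0) || (rho (p y) < i).
Proof.
move=> R; rewrite reach_card //; set A := [set y | _].
have [inj r0 lt lex] := R.
have down x z : rho x < rho z -> z \in A -> x \in A.
  rewrite !inE; have [-> //|x0] := eqVneq x ord0.
  have [->|z0] /= := eqVneq z ord0; first by rewrite r0.
  rewrite lex // => /orP [h | /andP [/eqP -> //]]; exact: ltn_trans.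
rewrite -[RHS](_ : y \in A = _); last by rewrite inE.
apply/idP/idP => [|yA].
  apply: contraTT => yA; rewrite -leqNgt -(card_rank_lt y inj).
  apply/subset_leq_card/subsetP => z zA; rewrite inE ltnNge.
  apply: contra yA; rewrite leq_eqVlt => /orP [/eqP/val_inj/inj -> //|/down]; exact.
rewrite -(card_rank_lt y inj); apply: proper_card; apply/properP; split.
  by apply/subsetP => z; rewrite inE => /down; apply.
by exists y; rewrite // inE ltnn.
Qed.

(** The vertex of rank [i.+1] has a parent of rank at most [i], so by [reachP] it lies within the
    first [reach] vertices. *)
Lemma parking_of_parking p rho : bfs_ranking p rho -> parking (parking_of p rho).
Proof.
move=> R; have [inj r0 lt lex] := R; apply/forallP => i.
pose y := invF inj (lift ord0 i).
have ry : rho y = i.+1 :> nat by rewrite f_invF.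
have y0 : y != ord0 by rewrite -(bfs_ranking_pos _ R) ry.
have := reachP i.+1 y R; rewrite (negPf y0) /= -{2}ry lt // ry ltnS.
by congr (_ < #|pred_of_set _|); apply/setP => c; rewrite !inE.
Qed.

(** * The tree of a parking function *)

Definition lex_lt f (c d : 'I_m) : bool := (f c < f d) || (f c == f d) && (c < d).

Lemma lex_lt_trans f c d e : lex_lt f c d -> lex_lt f d e -> lex_lt f c e.
Proof. by rewrite /lex_lt -!val_eqE /=; lia. Qed.

Lemma lex_lt_total f c d : [|| c == d, lex_lt f c d | lex_lt f d c].
Proof. by rewrite /lex_lt -!val_eqE /=; lia. Qed.

Lemma lex_lt_irr f c : lex_lt f c c = false.
Proof. by rewrite /lex_lt !ltnn andbF. Qed.

Definition lex_rank f x : 'I_m.+1 :=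
  if unlift ord0 x is Some c then inord (order_rank (lex_lt f) c).+1 else ord0.

Lemma lex_rankE f c : lex_rank f (lift ord0 c) = (order_rank (lex_lt f) c).+1 :> nat.
Proof.
rewrite /lex_rank liftK inordK // ltnS -[X in _ < X](card_ord m).
exact/order_rank_max/lex_lt_irr.
Qed.

Lemma lex_rank0 f : lex_rank f ord0 = ord0.
Proof. by rewrite /lex_rank unlift_none. Qed.

Lemma lex_rank_lt f c d :
  (lex_rank f (lift ord0 c) < lex_rank f (lift ord0 d)) = lex_lt f c d.
Proof.
rewrite !lex_rankE ltnS; apply: order_rank_lt; first exact: lex_lt_irr.
  by move=> e c' d'; apply: lex_lt_trans.
exact: lex_lt_total.
Qed.

Lemma lex_rank_inj f : injective (lex_rank f).
Proof.
move=> x y; case: (unliftP ord0 x) => [c ->|->]; case: (unliftP ord0 y) => [d ->|->] //.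
- move=> e; have := lex_lt_total f c d; rewrite -!lex_rank_lt e ltnn /= orbF.
  by move/eqP ->.
- by move/(congr1 val); rewrite /= lex_rankE lex_rank0.
by move/(congr1 val); rewrite /= lex_rankE lex_rank0.
Qed.

Definition lex_parent f x : 'I_m.+1 :=
  if unlift ord0 x is Some c then invF (@lex_rank_inj f) (inord (f c)) else ord0.

Lemma lex_rank_parent f c : lex_rank f (lex_parent f (lift ord0 c)) = f c :> nat.
Proof.
by rewrite /lex_parent liftK f_invF inordK // ltnW // ltnS.
Qed.

(** The parking condition says that at least [f c] cars prefer a spot before [f c]; they all precede
    [c], so the parent ranks below its child. *)
Lemma lex_bfs_ranking f : parking f -> bfs_ranking (lex_parent f) (lex_rank f).
Proof.
move=> park; split; [exact: lex_rank_inj | exact: lex_rank0 | |].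
  move=> x /lift0P [c ->]; rewrite lex_rank_parent lex_rankE ltnS.
  apply: (@leq_trans #|[set d | f d < f c]|).
    have := forallP park; case E: (f c) => [[|i] ic] //= park'.
    have := park' (Ordinal (ltnW ic : i < m)) => /leq_trans; apply.
    by apply/subset_leq_card/subsetP => d; rewrite !inE.
  by apply/subset_leq_card/subsetP => d; rewrite !inE /lex_lt => ->.
move=> x y /lift0P [c ->] /lift0P [d ->].
by rewrite lex_rank_lt -!val_eqE /= !lex_rank_parent /lex_lt -val_eqE /= /bump !add1n ltnS.
Qed.

Definition tree_of p : {set {set 'I_m.+1}} := [set [set x; p x] | x in [pred x | x != ord0]].

Lemma adj_tree_of p rho u v : bfs_ranking p rho ->
  adj (tree_of p) u v = ((v != ord0) && (u == p v)) || ((u != ord0) && (v == p u)).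
Proof.
case=> _ _ lt _; apply/idP/idP; last first.
  case/orP => /andP [x0 /eqP ->]; first by rewrite adjC; apply/imsetP; exists v.
  by apply/imsetP; exists u.
case/imsetP => x x0 e.
have xpx : x != p x by apply: contraTneq (lt x x0) => <-; rewrite ltnn.
have : u \in [set x; p x] by rewrite -e set21.
have : p x \in [set u; v] by rewrite e set22.
have : x \in [set u; v] by rewrite e set21.
rewrite !inE in x0 *; move=> h1 h2 /orP [/eqP uE | /eqP uE].
  subst u; move: h2; rewrite [p x == x]eq_sym (negPf xpx) /= => /eqP <-.
  by rewrite x0 eqxx orbT.
subst u; move: h1; rewrite (negPf xpx) /= => /eqP <-.
by rewrite x0 eqxx.
Qed.

Lemma is_tree_of p rho : bfs_ranking p rho -> is_tree (tree_of p).
Proof.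
move=> R; have [inj r0 lt lex] := R; apply/and3P; split.
- apply/forallP => e; apply/implyP => /imsetP [x x0 ->].
  rewrite cards2; suff -> : x != p x by [].
  by apply: contraTneq (lt x x0) => <-; rewrite ltnn.
- have symc : connect_sym (adj (tree_of p)) by apply: sym_connect_sym => a b; apply: adjC.
  have root v : connect (adj (tree_of p)) ord0 v.
    have [k] := ubnP (rho v); elim: k v => // k IH v; rewrite ltnS => lk.
    have [-> | v0] := eqVneq v ord0; first exact: connect0.
    apply: connect_trans (IH (p v) _) (connect1 _).
      by apply: leq_trans lk; apply: lt.
    by rewrite (adj_tree_of _ _ R) v0 eqxx.
  apply/forallP => u; apply/forallP => v.
  by apply: connect_trans (root v); rewrite symc.
(* A vertex of largest rank on a cycle would have two distinct parents. *)
apply/negP => /existsP [k /existsP [c /andP [k2 /andP [cyc uq]]]].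
have c0 : 0 < size c by rewrite size_tuple ltnW // ltnW.
pose x0 := nth ord0 c 0.
have x0c : x0 \in tval c by apply: mem_nth.
pose x := [arg max_(y > x0 in tval c) rho y]%N.
have [xc xmax] : x \in tval c /\ forall y, y \in tval c -> rho y <= rho x.
  by rewrite /x; case: arg_maxnP.
have [i s cE] := rot_to xc.
have mem_s y : y \in x :: s -> rho y <= rho x.
  by rewrite -cE mem_rot; apply: xmax.
have sz : size (x :: s) = k by rewrite -cE size_rot size_tuple.
move: cyc uq; rewrite -(rot_cycle i) -(rot_uniq i) cE.
case: s cE mem_s sz => [|a [|b s]] _ mem_s sz; rewrite -sz // in k2 *.
have par_x y : adj (tree_of p) x y -> rho y <= rho x -> y = p x.
  rewrite (adj_tree_of _ _ R) => /orP [] /andP [y0 /eqP -> //].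
  by rewrite leqNgt lt.
rewrite /= rcons_path => /and3P [xa _ /andP [_ lx]].
have aE : a = p x by apply: par_x; rewrite // mem_s // !inE eqxx orbT.
have lE : last b s = p x.
  by apply: par_x; rewrite 1?adjC // mem_s // 2!inE mem_last !orbT.
by rewrite aE -lE mem_last andbF.
Qed.

(** The edge from [v] to [p v] could only be oriented the other way if [v] were [p (p v)], which has
    smaller rank. *)
Lemma parent_tree_of p rho v : bfs_ranking p rho -> v != ord0 ->
  parent (tree_of p) ord0 v = p v.
Proof.
move=> R; have [inj r0 lt lex] := R; have treeT := is_tree_of R.
have [k] := ubnP (rho v); elim: k v => // k IH v; rewrite ltnS => lk v0.
have : adj (tree_of p) (p v) v by rewrite (adj_tree_of _ _ R) v0 eqxx.
rewrite (adj_parent ord0 treeT) => /orP [/andP [_ /eqP //] | /andP [pv0 /eqP vE]].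
have e : parent (tree_of p) ord0 (p v) = p (p v).
  by apply: IH pv0; apply: leq_trans lk; apply: lt.
have := ltn_trans (lt _ pv0) (lt _ v0).
by rewrite -e -vE ltnn.
Qed.

End Ranking.

(** * Trees and parking functions *)

Section TreeRanking.

Variables (m : nat) (T : {set {set 'I_m.+1}}).
Hypothesis treeT : is_tree T.
Implicit Types (u v w x y : 'I_m.+1).

Local Notation level := (dist T ord0).
Local Notation par := (parent T ord0).
Local Notation ch := (children T ord0).
Local Notation ss := (tree_strips T ord0).
Local Notation strip := (strip T ord0).

(** The order by shifted content, since strip numbers stay below the number of strips. *)
Definition shifted_lt x y :=
  (level x < level y) || (level x == level y) && (strip x < strip y).

Lemma shifted_lt_irr : irreflexive shifted_lt.
Proof. by move=> x; rewrite /shifted_lt !ltnn andbF. Qed.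

Lemma shifted_lt_trans : transitive shifted_lt.
Proof. by move=> y x z; rewrite /shifted_lt; lia. Qed.

Lemma shifted_lt_total x y : [|| x == y, shifted_lt x y | shifted_lt y x].
Proof.
rewrite /shifted_lt; case: (ltngtP (level x) (level y)) => lxy; rewrite ?orbT //=.
case: (ltngtP (strip x) (strip y)) => sxy; rewrite ?orbT //=.
by rewrite (strip_level_inj treeT sxy lxy) eqxx.
Qed.

Definition shifted_rank x : 'I_m.+1 := inord (order_rank shifted_lt x).

Lemma shifted_rank_lt x y : (shifted_rank x < shifted_rank y) = shifted_lt x y.
Proof.
have bound z : order_rank shifted_lt z < m.+1.
  by rewrite -[X in _ < X](card_ord m.+1); apply/order_rank_max/shifted_lt_irr.
rewrite !inordK //; apply: order_rank_lt; first exact: shifted_lt_irr.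
  exact: shifted_lt_trans.
exact: shifted_lt_total.
Qed.

Lemma shifted_rank_inj : injective shifted_rank.
Proof.
move=> x y e; have := shifted_lt_total x y.
by rewrite -!shifted_rank_lt e ltnn !orbF => /eqP.
Qed.

Lemma level_parent x : x != ord0 -> level x = (level (par x)).+1.
Proof. by move=> x0; have [] := parentP treeT x0. Qed.

Lemma mem_children_parent x : x != ord0 -> x \in ch (par x).
Proof. by move=> x0; rewrite mem_children // x0 eqxx. Qed.

Lemma shifted_lt_parents x y : x != ord0 -> y != ord0 ->
  shifted_lt (par x) (par y) || (par x == par y) && (x < y) -> shifted_lt x y.
Proof.
move=> x0 y0; rewrite /shifted_lt (level_parent x0) (level_parent y0) ltnS eqSS.
case/orP => [/orP [-> // | /andP [/eqP lxy sxy]] | /andP [/eqP pxy xy]].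
  rewrite lxy eqxx ltnn /=; apply: leq_trans (strip_parent treeT y0).
  exact: strip_child_lt lxy sxy (mem_children_parent x0).
by rewrite pxy ltnn eqxx (strip_siblings treeT x0 y0 pxy xy).
Qed.

(** One implication of the lexicographic rule is [shifted_lt_parents]; totality of the order gives
    the other. *)
Lemma tree_bfs_ranking : bfs_ranking par shifted_rank.
Proof.
split; first exact: shifted_rank_inj.
- apply/val_inj/eqP; rewrite /= -leqn0 leqNgt.
  apply/negP => h; have : shifted_lt (invF shifted_rank_inj ord0) ord0.
    by rewrite -shifted_rank_lt f_invF.
  by rewrite /shifted_lt level_root ltn0 /= level_eq0 // => /andP [/eqP ->]; rewrite ltnn.
- by move=> x x0; rewrite shifted_rank_lt /shifted_lt [level x]level_parent // ltnSn.
move=> x y x0 y0; rewrite !shifted_rank_lt (inj_eq shifted_rank_inj).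
apply/idP/idP; last exact: shifted_lt_parents.
move=> ltxy; apply/negPn/negP; rewrite negb_or => /andP [n1 n2].
have : shifted_lt y x.
  apply: shifted_lt_parents => //.
  case/or3P: (shifted_lt_total (par x) (par y)) => [pxy|h|->//].
    rewrite pxy -leqNgt leq_eqVlt in n2; rewrite [par y == _]eq_sym pxy.
    case/orP: n2 => [/eqP/val_inj yx | ->]; last by rewrite orbT.
    by rewrite yx shifted_lt_irr in ltxy.
  by rewrite h in n1.
by move/(shifted_lt_trans ltxy); rewrite shifted_lt_irr.
Qed.

Local Notation fT := (parking_of par shifted_rank).

(** The vertices before [z] are the root and the children of vertices before [x]. Thus diagonal
    steps correspond to pairs of consecutive cells in a strip. *)
Lemma shifted_rank_first_child x z s : ch x = z :: s ->
  shifted_rank z = reach fT (shifted_rank x) :> nat.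
Proof.
move=> e; have zx : z \in ch x by rewrite e mem_head.
have := zx; rewrite mem_children // => /andP [z0 /eqP pz].
have R := tree_bfs_ranking; have [inj r0 lt lex] := R.
rewrite (reach_card _ R) -(card_rank_lt z inj); congr #|pred_of_set _|.
apply/setP => y; rewrite !inE; have [-> | y0] := eqVneq y ord0.
  by rewrite r0 (bfs_ranking_pos _ R).
rewrite lex // pz; case: eqP => [/inj py | _]; last by rewrite orbF.
have : y \in ch x by rewrite mem_children // y0 py eqxx.
by move/(children_head e); rewrite leqNgt => /negPf ->; rewrite orbF.
Qed.

Lemma has_dstep_first_child x z s : ch x = z :: s ->
  has_dstep (parking_path fT) (shifted_rank x) (shifted_rank z).
Proof.
move=> e; have zx : z \in ch x by rewrite e mem_head.
have := zx; rewrite mem_children // => /andP [z0 /eqP pz].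
rewrite has_dstep_parking (shifted_rank_first_child e) eqxx andbT.
have [c zE] := lift0P z0; apply/existsP; exists c.
by rewrite (parking_ofE _ tree_bfs_ranking) -zE pz.
Qed.

Lemma has_dstepP (i j : 'I_m.+1) : has_dstep (parking_path fT) i j ->
  exists x z s, [/\ ch x = z :: s, i = shifted_rank x & j = shifted_rank z].
Proof.
rewrite has_dstep_parking => /andP [/existsP [c /eqP ci] /eqP jE].
have iE : i = shifted_rank (par (lift ord0 c)).
  by apply: val_inj; rewrite /= -ci (parking_ofE _ tree_bfs_ranking).
have : lift ord0 c \in ch (par (lift ord0 c)) by apply: mem_children_parent.
case e: (ch (par (lift ord0 c))) => [|z s] // _.
exists (par (lift ord0 c)), z, s; split=> //.
by apply: val_inj; rewrite /= (shifted_rank_first_child e) -iE.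
Qed.

(** The right side is the inversion window of shifted contents. On consecutive levels the
    equivalence rests on [strip_child_lt] in one direction and [strip_parent] in the other. *)
Lemma shifted_lt_weak x y :
  (shifted_rank x < shifted_rank y) && (shifted_rank y < reach fT (shifted_rank x)) =
  (level y == level x) && (strip x < strip y) ||
  (level y == (level x).+1) && (strip y < strip x).
Proof.
have R := tree_bfs_ranking.
rewrite (reachP _ _ R) !shifted_rank_lt.
have [-> | y0] := eqVneq y ord0.
  rewrite /shifted_lt level_root ltn0 /= andbT orbF.
  by rewrite [_ == level x]eq_sym.
have spy := strip_parent treeT y0.
have child : level (par y) = level x -> strip (par y) < strip x -> strip y < strip x.
  move=> l h; exact: strip_child_lt l h (mem_children_parent y0).
rewrite /= /shifted_lt (level_parent y0).
case: (ltngtP (level (par y)) (level x)) => l /=.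
- by rewrite eqSS (ltn_eqF l) /= orbF andbT ltnS leqNgt l /= eq_sym.
- by rewrite andbF eqSS (gtn_eqF l) gtn_eqF // ltnW.
rewrite l ltnSn eqxx /= gtn_eqF //=.
by apply/idP/idP => [/child->//|]; apply: leq_ltn_trans.
Qed.

Lemma shifted_content_weak (k lx ly sx sy : nat) : sx < k -> sy < k ->
  (0 < (k%:Z * ly%:Z + sy.+1%:Z) - (k%:Z * lx%:Z + sx.+1%:Z) < k%:Z)%R =
  (ly == lx) && (sx < sy) || (ly == lx.+1) && (sy < sx).
Proof.
move=> hx hy; case: (ltngtP ly lx) => [l | l | ->] /=.
- have : (k * ly + k <= k * lx) by rewrite -mulnSr leq_mul2l l orbT.
  by rewrite (_ : ly == lx.+1 = false); lia.
- case: (ltngtP ly lx.+1) => [|l2 | ->]; first by rewrite ltnS leqNgt l.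
    have : (k * lx + k + k <= k * ly) by rewrite -!mulnSr leq_mul2l l2 orbT.
    by lia.
  by rewrite -!PoszM mulnS; lia.
by rewrite (_ : lx == lx.+1 = false); lia.
Qed.

(** * Cells of the strips as vertices of the tree *)

Local Notation nuT := (nu T ord0).

Definition cell_vertex (a : cell nuT) : 'I_m.+1 :=
  nth ord0 (nth [::] ss (tag a)) (tagged a).

Lemma size_nu : size nuT = size ss.
Proof. by rewrite size_map. Qed.

Lemma nth_nu i : i < size ss ->
  nth [::] nuT i = [seq Posz (level v) | v <- nth [::] ss i].
Proof. by move=> lti; rewrite (nth_map [::]). Qed.

Lemma cell_strip (a : cell nuT) : tag a < size ss.
Proof. by rewrite -size_nu. Qed.

Lemma cell_pos (a : cell nuT) : tagged a < size (nth [::] ss (tag a)).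
Proof.
by have := ltn_ord (tagged a); rewrite {2}nth_nu ?cell_strip // size_map.
Qed.

Lemma strip_cell (a : cell nuT) : strip (cell_vertex a) = tag a.
Proof.
by apply/eqP; rewrite -mem_strip ?cell_strip //; apply: mem_nth; apply: cell_pos.
Qed.

Lemma content_cell (a : cell nuT) : content a = Posz (level (cell_vertex a)).
Proof.
rewrite /content /cell_vertex; move: (cell_pos a); move: (nat_of_ord (tagged a)) => j pj.
by rewrite nth_nu ?cell_strip // (nth_map ord0).
Qed.

Lemma cell_vertex_inj : injective cell_vertex.
Proof.
move=> a b e; have := strip_cell a; rewrite e strip_cell.
have := cell_pos a; have := cell_pos b; move: e; rewrite /cell_vertex.
have := cell_strip a.
case: a b => [i j] [i' j'] /= lti e pj' pj /val_inj ii'; subst i'.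
congr existT; apply: val_inj; have [dE _] := nth_strips (lti : i < size ss).
rewrite dE in e pj pj'.
have /(pairwiseP ord0) pw := descend_pairwise ord0 treeT m.+1 (start T ord0 i).
case: (ltngtP (val j) (val j')) => // jj.
  by have := pw _ _ pj pj' jj; rewrite e ltnn.
by have := pw _ _ pj' pj jj; rewrite e ltnn.
Qed.

Lemma cell_vertex_surj v : exists a, cell_vertex a = v.
Proof.
have lts := strip_lt ord0 treeT v.
have vs : v \in nth [::] ss (strip v) by rewrite mem_strip.
have lti : strip v < size nuT by rewrite size_nu.
have ltj : index v (nth [::] ss (strip v)) < size (nth [::] nuT (Ordinal lti)).
  by rewrite nth_nu // size_map index_mem.
exists (existT _ (Ordinal lti) (Ordinal ltj)).
by rewrite /cell_vertex /= nth_index.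
Qed.

(** Sending a cell to the rank of its vertex matches fillings, strict decrease along strips with
    diagonal steps, and inversion windows with boxes below the path. *)
Lemma LLT_tree : LLT nuT = LLT_mu m.+1 (parking_path fT).
Proof.
pose phi a := shifted_rank (cell_vertex a).
have phi_bij : bijective phi.
  exists (fun i => projT1 (cid (cell_vertex_surj (invF shifted_rank_inj i)))).
    move=> a; apply: cell_vertex_inj; case: cid => b /= ->.
    by apply: shifted_rank_inj; rewrite f_invF.
  by move=> i; rewrite /phi; case: cid => b /= ->; rewrite f_invF.
have [psi phiK psiK] := phi_bij.
apply: (filling_sum_bij phi_bij) => g.
  apply/forallP/forallP => [adm a | adm i].
    apply/forallP => b; apply/implyP => /andP [/eqP tab].
    rewrite !content_cell ltz_nat /phi /=.
    have : strip (cell_vertex b) = strip (cell_vertex a) by rewrite !strip_cell tab.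
    move: (cell_vertex a) (cell_vertex b) => x y.
    (* Diagonal steps compare consecutive cells only; induction on the level chains these
       comparisons down the strip. *)
    have [k] := ubnP (level y); elim: k y => // k IH y; rewrite ltnS => lk syx lxy.
    have [y0 spy [s es]] := strip_chain treeT syx lxy.
    have /forallP /(_ (shifted_rank y)) := adm (shifted_rank (par y)).
    rewrite (has_dstep_first_child es) /= => gy.
    move: lxy; rewrite (level_parent y0) ltnS leq_eqVlt => /orP [/eqP e | lxy].
      by rewrite (strip_level_inj treeT (esym (etrans spy syx)) e).
    apply: ltn_trans gy (IH _ _ _ lxy); last by rewrite spy.
    by rewrite -level_parent.
  apply/forallP => j; apply/implyP => /has_dstepP [x [z [s [e -> ->]]]].
  have zx : z \in ch x by rewrite e mem_head.
  have := zx; rewrite mem_children // => /andP [z0 /eqP pz].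
  have [a ax] := cell_vertex_surj x; have [b bz] := cell_vertex_surj z.
  have /forallP /(_ b) := adm a; rewrite !content_cell ax bz ltz_nat.
  rewrite (level_parent z0) pz ltnSn andbT /phi /= ax bz => /implyP; apply.
  by apply/eqP/val_inj; rewrite /= -!strip_cell ax bz; apply/esym/(strip_first_child treeT e).
rewrite /schroeder_inv (card_pairs (fun i j : 'I_m.+1 =>
  [&& i < j, box_below (parking_path fT) i j & g j < g i])).
apply/esym; apply: etrans (card_pairs (fun a b : cell nuT =>
  (0 < shifted_content b - shifted_content a < (size nuT)%:Z)%R &&
  ((g \o phi) b < (g \o phi) a))) _; apply/esym.
rewrite (reindex phi); last by exists psi => x _; rewrite ?phiK ?psiK.
apply: eq_bigr => a _; rewrite (reindex phi); last first.
  by exists psi => x _; rewrite ?phiK ?psiK.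
apply: eq_bigr => b _; rewrite andbA; congr (nat_of_bool (_ && _)).
rewrite box_below_parking -1?ltnS // /phi shifted_lt_weak.
rewrite /shifted_content !content_cell -!strip_cell size_nu.
by rewrite shifted_content_weak // strip_lt.
Qed.

End TreeRanking.

Local Open Scope ring_scope.

Lemma sum_trees_parking m :
  \sum_(T : {set {set 'I_m.+1}} | is_tree T) LLT (nu T ord0) =
  \sum_(f : {ffun 'I_m -> 'I_m} | parking f) LLT_mu m.+1 (parking_path f).
Proof.
pose to_f (T : {set {set 'I_m.+1}}) := parking_of (parent T ord0) (shifted_rank T).
pose to_T (f : {ffun 'I_m -> 'I_m}) := tree_of (lex_parent f).
have to_T_tree f : parking f -> is_tree (to_T f).
  by move=> /lex_bfs_ranking; apply: is_tree_of.
have to_TK f : parking f -> to_f (to_T f) = f.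
  move=> park; have R := lex_bfs_ranking park.
  have treeT := to_T_tree f park; have R' := tree_bfs_ranking treeT.
  have pE x : x != ord0 -> parent (to_T f) ord0 x = lex_parent f x.
    exact: parent_tree_of R.
  have R'' : bfs_ranking (lex_parent f) (shifted_rank (to_T f)).
    have [inj r0 lt lex] := R'; split=> // [x x0 | x y x0 y0].
      by rewrite -pE // lt.
    by rewrite -!pE // lex.
  apply/ffunP => c; apply: val_inj; rewrite /= (parking_ofE _ R') pE //.
  by rewrite (bfs_ranking_unique R'' R) lex_rank_parent.
have to_fK T : is_tree T -> to_T (to_f T) = T.
  move=> treeT; have R := tree_bfs_ranking treeT.
  have park := parking_of_parking R; have treeT' := to_T_tree _ park.
  have R' := tree_bfs_ranking treeT'.
  (* Both trees have the same parking function by [to_TK], so [bfs_ranking_parents] gives equal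
     parents, and these determine the edges. *)
  have pE x : x != ord0 -> parent (to_T (to_f T)) ord0 x = parent T ord0 x.
    apply: (bfs_ranking_parents R' R) => {}x x0; have [c ->] := lift0P x0.
    apply: val_inj; rewrite /= -(parking_ofE c R') -(parking_ofE c R).
    by rewrite -[in RHS](to_TK _ park).
  rewrite [LHS](tree_edges ord0 treeT') [RHS](tree_edges ord0 treeT).
  by apply: eq_in_imset => x; rewrite inE => x0; rewrite pE.
rewrite [RHS](reindex_onto to_f to_T) //=.
apply: eq_big => [T | T treeT]; last exact: LLT_tree.
apply/idP/andP => [treeT | [park /eqP <-]]; last exact: to_T_tree.
by rewrite to_fK // eqxx; split; first exact: parking_of_parking (tree_bfs_ranking treeT).
Qed.

Theorem theorem1p1 (n : nat) (n_gt0 : (0 < n)%N) :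
  kappa_D n = \sum_(T : {set {set 'I_n}} | is_tree T) LLT (nu T (Ordinal n_gt0))
  /\
  \sum_(T : {set {set 'I_n}} | is_tree T) LLT (nu T (Ordinal n_gt0)) =
    \sum_(f : {ffun 'I_n.-1 -> 'I_n.-1} | parking f) LLT_mu n (parking_path f).
Proof.
case: n n_gt0 => // m m_gt0; have -> : Ordinal m_gt0 = ord0 by apply: val_inj.
by rewrite sum_trees_parking sum_LLT_mu kappa_D_trees.
Qed.
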